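(* Let $G$ be a countable discrete weakly rigid group, let $(X_0,\mu_0)$ be a nontrivial standard probability space, and let $\sigma$ be the $G$-Bernoulli shift action on $(X,\mu)=\prod_{g\in G}(X_0,\mu_0)_g$. Then every 1-cocycle $w$ for $\sigma$ is equivalent to a character of $G$, and distinct characters of $G$ give non-equivalent 1-cocycles. In other words, $H^1(\sigma)=\mathrm{Char}(G)$: the map sending a character $\gamma:G\to\mathbb T$ to the class of the 1-cocycle $g\mapsto\gamma(g)1$ is a group isomorphism from $\mathrm{Char}(G)$ onto $H^1(\sigma)$.
   Context: The $G$-Bernoulli shift is the measure-preserving action $\sigma_g((x_h)_h)=(x_{g^{-1}h})_h$ of $G$ on $(X,\mu)=\prod_{g\in G}(X_0,\mu_0)_g$, where $(X_0,\mu_0)_g$ are identical copies of $(X_0,\mu_0)$. It induces an action, still denoted $\sigma$, on $A=L^\infty(X,\mu)$ by $\sigma_g(f)=f\circ\sigma_{g^{-1}}$. $\mathcal U(A)$ is the group of unitary elements ($\mathbb T$-valued functions) of $A$. A 1-cocycle for $\sigma$ is a map $w:G\to\mathcal U(A)$ with $w_{gh}=w_g\sigma_g(w_h)$ for all $g,h\in G$ and $w_e=1$. It is a coboundary if there is $v\in\mathcal U(A)$ with $w_g=v\sigma_g(v^* )$ for all $g\in G$. Under pointwise multiplication the 1-cocycles form an abelian group $Z^1(\sigma)$ and the coboundaries a subgroup $B^1(\sigma)$; $H^1(\sigma)=Z^1(\sigma)/B^1(\sigma)$. Two 1-cocycles $w,w'$ are equivalent if there is $v\in\mathcal U(A)$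 with $w'_g=vw_g\sigma_g(v^* )$ for all $g$, i.e. if they have the same class in $H^1(\sigma)$. A character $\gamma:G\to\mathbb T$ (group homomorphism) is regarded as the 1-cocycle $g\mapsto\gamma(g)1$; $\mathrm{Char}(G)$ is the group of characters under pointwise multiplication. An inclusion of discrete groups $H\subset G$ has the relative property (T) if there exist a finite set $g_1,\dots,g_n\in G$ and $\epsilon>0$ such that every unitary representation $\pi$ of $G$ on a Hilbert space $\mathcal H$ having a unit vector $\xi$ with $\|\pi(g_i)\xi-\xi\|<\epsilon$ for all $1\le i\le n$ has a unit vector fixed by $\pi|_H$. $G$ is weakly rigid if it contains an infinite normal subgroup $H$ such that $(G,H)$ has the relative property (T). *)

(* Defs.v *)
From HB Require Import structures.
From mathcomp Require Import all_boot all_order all_algebra.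
From mathcomp Require Import sesquilinear generic_quotient.
From mathcomp Require Import complex.
From mathcomp Require Import all_classical all_reals all_analysis.
From mathcomp Require Import measurable_realfun.

Set Implicit Arguments.
Unset Strict Implicit.
Unset Printing Implicit Defensive.

Import Order.TTheory GRing.Theory Num.Theory.
Import numFieldNormedType.Exports.

Local Open Scope classical_set_scope.
Local Open Scope ring_scope.

Section normal_subgroup.
Local Open Scope group_scope.

Record normal_subgroup (A : groupType) := NormalSubgroup {
  nsub_carrier :> A -> Prop;
  nsub1 : nsub_carrier 1;
  nsubM : forall x y, nsub_carrier x -> nsub_carrier y -> nsub_carrier (x * y);
  nsubV : forall x, nsub_carrier x -> nsub_carrier x^-1;
  nsubJ : forall x y, nsub_carrier x -> nsub_carrier (x ^ y)
}.

End normal_subgroup.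

Section quotient_group.
Local Open Scope group_scope.
Local Open Scope quotient_scope.
Variables (A : groupType) (N : normal_subgroup A).

Definition coset_rel (x y : A) := `[< N (x^-1 * y) >].

Let coset_refl : reflexive coset_rel.
Proof. by move=> x; apply/asboolP; rewrite mulVg; exact: nsub1. Qed.

Let coset_sym : symmetric coset_rel.
Proof.
by move=> x y; apply/asboolP/asboolP => /nsubV; rewrite invgM invgK.
Qed.

Let coset_trans : transitive coset_rel.
Proof.
move=> y x z /asboolP xy /asboolP yz; apply/asboolP.
by rewrite -[z](mulVKg y) mulgA; exact: nsubM.
Qed.

Canonical coset_equiv := EquivRel coset_rel coset_refl coset_sym coset_trans.

Definition quotient_group : Type := {eq_quot coset_rel}.
HB.instance Definition _ := Choice.on quotient_group.
HB.instance Definition _ := EqQuotient.on quotient_group.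

Lemma quotient_eqP (x y : A) :
  \pi_quotient_group x = \pi_quotient_group y <-> N (x^-1 * y).
Proof. by split=> [/eqmodP/asboolP//|Nxy]; apply/eqmodP/asboolP. Qed.

Definition quotient_one : quotient_group := \pi_quotient_group 1.
Definition quotient_mul (a b : quotient_group) : quotient_group :=
  \pi_quotient_group (repr a * repr b).
Definition quotient_inv (a : quotient_group) : quotient_group :=
  \pi_quotient_group (repr a)^-1.

Lemma quotient_ind (P : quotient_group -> Prop) :
  (forall x, P (\pi_quotient_group x)) -> forall a, P a.
Proof. by move=> Px a; rewrite -[a]reprK. Qed.

Let repr_pi (x : A) : N ((repr (\pi_quotient_group x))^-1 * x).
Proof. by apply/quotient_eqP; rewrite reprK. Qed.

Lemma quotient_mulE (x y : A) :
  quotient_mul (\pi_quotient_group x) (\pi_quotient_group y) = \pi_quotient_group (x * y).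
Proof.
apply/quotient_eqP; set a := repr _; set b := repr _.
have Na : N (a^-1 * x) := repr_pi x; have Nb : N (b^-1 * y) := repr_pi y.
have -> : (a * b)^-1 * (x * y) = (a^-1 * x) ^ b * (b^-1 * y).
  by rewrite conjgE invgM !mulgA mulgK.
by apply: nsubM => //; exact: nsubJ.
Qed.

Lemma quotient_invE (x : A) : quotient_inv (\pi_quotient_group x) = \pi_quotient_group x^-1.
Proof.
apply/quotient_eqP; set a := repr _.
have Na : N (a^-1 * x) := repr_pi x.
have -> : (a^-1)^-1 * x^-1 = ((a^-1 * x)^-1) ^ a^-1.
  by rewrite conjgE invgM !invgK !mulgA mulgK.
by apply: nsubJ; exact: nsubV.
Qed.

Let quotient_mulA : associative quotient_mul.
Proof.
elim/quotient_ind => x; elim/quotient_ind => y; elim/quotient_ind => z.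
by rewrite !quotient_mulE mulgA.
Qed.

Let quotient_mul1 : left_id quotient_one quotient_mul.
Proof. by elim/quotient_ind => x; rewrite quotient_mulE mul1g. Qed.

Let quotient_1mul : right_id quotient_one quotient_mul.
Proof. by elim/quotient_ind => x; rewrite quotient_mulE mulg1. Qed.

Let quotient_mulV : left_inverse quotient_one quotient_inv quotient_mul.
Proof. by elim/quotient_ind => x; rewrite quotient_invE quotient_mulE mulVg. Qed.

Let quotient_Vmul : right_inverse quotient_one quotient_inv quotient_mul.
Proof. by elim/quotient_ind => x; rewrite quotient_invE quotient_mulE mulgV. Qed.

HB.instance Definition _ := isGroup.Build quotient_group
  quotient_mulA quotient_mul1 quotient_1mul quotient_mulV quotient_Vmul.

End quotient_group.

Definition circle (R : realType) : Type := {z : R[i] | `|z| == 1}.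

Definition circle_display : measure_display.
Proof. exact: default_measure_display. Qed.

Section circle.
Variable R : realType.

HB.instance Definition _ := SubChoice.on (circle R).

Definition circle_one : circle R := exist _ 1 (introT eqP (normr1 _)).

Let circle_mul_subproof (a b : circle R) : `|val a * val b| == 1.
Proof. by rewrite normrM (eqP (valP a)) (eqP (valP b)) mulr1. Qed.

Definition circle_mul (a b : circle R) : circle R :=
  exist _ (val a * val b) (circle_mul_subproof a b).

Let circle_inv_subproof (a : circle R) : `|(val a)^-1| == 1.
Proof. by rewrite normfV (eqP (valP a)) invr1. Qed.

Definition circle_inv (a : circle R) : circle R :=
  exist _ (val a)^-1 (circle_inv_subproof a).

Let circle_neq0 (a : circle R) : val a != 0.
Proof. by rewrite -normr_eq0 (eqP (valP a)) oner_eq0. Qed.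

Let circle_mulC : commutative circle_mul.
Proof. by move=> a b; apply: val_inj; rewrite /= mulrC. Qed.

Let circle_mulA : associative circle_mul.
Proof. by move=> a b c; apply: val_inj; rewrite /= mulrA. Qed.

Let circle_mul1 : left_id circle_one circle_mul.
Proof. by move=> a; apply: val_inj; rewrite /= mul1r. Qed.

Let circle_1mul : right_id circle_one circle_mul.
Proof. by move=> a; apply: val_inj; rewrite /= mulr1. Qed.

Let circle_mulV : left_inverse circle_one circle_inv circle_mul.
Proof. by move=> a; apply: val_inj; rewrite /= mulVf //; exact: circle_neq0. Qed.

Let circle_Vmul : right_inverse circle_one circle_inv circle_mul.
Proof. by move=> a; apply: val_inj; rewrite /= mulfV //; exact: circle_neq0. Qed.

HB.instance Definition _ := isGroup.Build (circle R)
  circle_mulA circle_mul1 circle_1mul circle_mulV circle_Vmul.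

Lemma circle_mulgC (a b : circle R) : (a * b = b * a)%g.
Proof. exact: circle_mulC. Qed.

Lemma circle_valM (a b : circle R) : val (a * b)%g = val a * val b.
Proof. by []. Qed.

Lemma circle_valV (a : circle R) : val (a^-1)%g = (val a)^-1.
Proof. by []. Qed.

HB.instance Definition _ := isPointed.Build (circle R) circle_one.

Definition circle_coord (a : circle R) : measurableTypeR R * measurableTypeR R :=
  (complex.Re (val a), complex.Im (val a)).

(* the trace on the circle of the Borel sigma-algebra of R^2 *)
Definition circle_measurable : set (set (circle R)) :=
  preimage_set_system setT circle_coord measurable.

Let circle_sigma_algebra : sigma_algebra setT circle_measurable.
Proof. exact/sigma_algebra_preimage/sigma_algebra_measurable. Qed.

Let circle_measurable0 : circle_measurable set0.
Proof. by case: circle_sigma_algebra. Qed.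

Let circle_measurableC (A : set (circle R)) :
  circle_measurable A -> circle_measurable (~` A).
Proof. by case: circle_sigma_algebra => _ + _ => /[apply]; rewrite setTD. Qed.

Let circle_measurable_bigcup (F : (set (circle R))^nat) :
  (forall i, circle_measurable (F i)) -> circle_measurable (\bigcup_i F i).
Proof. by case: circle_sigma_algebra => _ _; exact. Qed.

HB.instance Definition _ := isMeasurable.Build circle_display (circle R)
  circle_measurable0 circle_measurableC circle_measurable_bigcup.

End circle.

Section circle_measurable.
Context d (X : measurableType d) (R : realType).

Lemma measurable_circleP (f : X -> circle R) :
  measurable_fun setT f <->
  measurable_fun setT (fun x => complex.Re (val (f x)) : measurableTypeR R) /\
  measurable_fun setT (fun x => complex.Im (val (f x)) : measurableTypeR R).
Proof.
split=> [mf|[mRe mIm]].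
  have mc : measurable_fun setT (@circle_coord R).
    by move=> _ B mB; exists B.
  have mcf := measurableT_comp mc mf.
  split; first exact: (measurableT_comp measurable_fst mcf).
  exact: (measurableT_comp measurable_snd mcf).
move=> _ _ [B mB <-].
have mcf : measurable_fun setT (@circle_coord R \o f).
  exact: (measurable_fun_pair mRe mIm).
by have := mcf measurableT B mB; rewrite !setTI.
Qed.

Lemma measurable_circleM (f g : {mfun X >-> circle R}) :
  measurable_fun setT (fun x => f x * g x)%g.
Proof.
have [fr fi] := (measurable_circleP f).1 (@measurable_funPT _ _ _ _ f).
have [gr gi] := (measurable_circleP g).1 (@measurable_funPT _ _ _ _ g).
apply/measurable_circleP; split.
  rewrite (_ : (fun x => _) = fun x =>
    complex.Re (val (f x)) * complex.Re (val (g x)) -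
    complex.Im (val (f x)) * complex.Im (val (g x))).
    by apply: measurable_funB; exact: measurable_funM.
  apply/funext => x; rewrite circle_valM.
  by case: (val (f x)) (val (g x)) => [a b] [a' b'].
rewrite (_ : (fun x => _) = fun x =>
  complex.Re (val (f x)) * complex.Im (val (g x)) +
  complex.Im (val (f x)) * complex.Re (val (g x))).
  by apply: measurable_funD; exact: measurable_funM.
apply/funext => x; rewrite circle_valM.
by case: (val (f x)) (val (g x)) => [a b] [a' b'].
Qed.

Lemma circle_valVE (a : circle R) :
  val (a^-1)%g = Complex (complex.Re (val a)) (- complex.Im (val a)).
Proof.
rewrite circle_valV invC_norm (eqP (valP a)) expr1n invr1 mul1r.
by case: (val a).
Qed.

Lemma measurable_circleV (f : {mfun X >-> circle R}) :
  measurable_fun setT (fun x => (f x)^-1)%g.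
Proof.
have [fr fi] := (measurable_circleP f).1 (@measurable_funPT _ _ _ _ f).
apply/measurable_circleP; split.
  by under eq_fun do rewrite circle_valVE.
under eq_fun do rewrite circle_valVE /=.
exact: measurableT_comp.
Qed.

Definition circle_funM (f g : X -> circle R) x := (f x * g x)%g.
Definition circle_funV (f : X -> circle R) x := (f x)^-1%g.

HB.instance Definition _ (f g : {mfun X >-> circle R}) :=
  isMeasurableFun.Build _ _ _ _ (circle_funM f g) (measurable_circleM f g).
HB.instance Definition _ (f : {mfun X >-> circle R}) :=
  isMeasurableFun.Build _ _ _ _ (circle_funV f) (measurable_circleV f).

End circle_measurable.

Section unitary.
Local Open Scope quotient_scope.
Context d (X : measurableType d) (R : realType) (mu : probability X R).

(* the unitary group of L^oo(X, mu): circle-valued measurable functions modulo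
   equality almost everywhere *)
Definition unitary : Type := {mfun_ mu, X >-> circle R}.
HB.instance Definition _ := Choice.on unitary.
HB.instance Definition _ := EqQuotient.on unitary.

Definition to_unitary (f : {mfun X >-> circle R}) : unitary :=
  \pi_unitary f.

Lemma unitary_eqP (f g : {mfun X >-> circle R}) :
  to_unitary f = to_unitary g <-> f = g %[ae mu].
Proof. by split=> [/eqmodP/asboolP//|fg]; apply/eqmodP/asboolP. Qed.

Lemma unitary_ind (P : unitary -> Prop) :
  (forall f, P (to_unitary f)) -> forall u, P u.
Proof. by move=> Pf u; rewrite -[u]reprK; exact: Pf. Qed.

Lemma repr_to_unitary (f : {mfun X >-> circle R}) :
  (repr (to_unitary f) : X -> circle R) = f %[ae mu].
Proof. by apply/unitary_eqP; rewrite /to_unitary reprK. Qed.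

Definition unitary_one : unitary := to_unitary (cst 1%g).
Definition unitary_mul (u v : unitary) : unitary :=
  to_unitary (circle_funM (repr u) (repr v)).
Definition unitary_inv (u : unitary) : unitary :=
  to_unitary (circle_funV (repr u)).

Lemma unitary_mulE (f g : {mfun X >-> circle R}) :
  unitary_mul (to_unitary f) (to_unitary g) = to_unitary (circle_funM f g).
Proof.
apply/unitary_eqP; apply: filterS2 (repr_to_unitary f) (repr_to_unitary g).
by move=> x /= fx gx _; rewrite /circle_funM fx ?gx.
Qed.

Lemma unitary_invE (f : {mfun X >-> circle R}) :
  unitary_inv (to_unitary f) = to_unitary (circle_funV f).
Proof.
apply/unitary_eqP; apply: filterS (repr_to_unitary f).
by move=> x /= fx _; rewrite /circle_funV fx.
Qed.

Let to_unitary_ext (f g : {mfun X >-> circle R}) :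
  f =1 g -> to_unitary f = to_unitary g.
Proof. by move=> fg; apply/unitary_eqP; apply: aeW => x _; exact: fg. Qed.

Let unitary_mulA : associative unitary_mul.
Proof.
elim/unitary_ind => f; elim/unitary_ind => g; elim/unitary_ind => h.
by rewrite !unitary_mulE; apply: to_unitary_ext => x; exact: mulgA.
Qed.

Let unitary_mul1 : left_id unitary_one unitary_mul.
Proof.
elim/unitary_ind => f.
by rewrite unitary_mulE; apply: to_unitary_ext => x; exact: mul1g.
Qed.

Let unitary_1mul : right_id unitary_one unitary_mul.
Proof.
elim/unitary_ind => f.
by rewrite unitary_mulE; apply: to_unitary_ext => x; exact: mulg1.
Qed.

Let unitary_mulV : left_inverse unitary_one unitary_inv unitary_mul.
Proof.
elim/unitary_ind => f; rewrite unitary_invE unitary_mulE.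
by apply: to_unitary_ext => x; exact: mulVg.
Qed.

Let unitary_Vmul : right_inverse unitary_one unitary_inv unitary_mul.
Proof.
elim/unitary_ind => f; rewrite unitary_invE unitary_mulE.
by apply: to_unitary_ext => x; exact: mulgV.
Qed.

HB.instance Definition _ := isGroup.Build unitary
  unitary_mulA unitary_mul1 unitary_1mul unitary_mulV unitary_Vmul.

Lemma unitary_mulgC (u v : unitary) : (u * v = v * u)%g.
Proof.
elim/unitary_ind: u => f; elim/unitary_ind: v => g.
rewrite [LHS]unitary_mulE [RHS]unitary_mulE.
by apply: to_unitary_ext => x; exact: circle_mulgC.
Qed.

End unitary.

Section measure_preserving_action.
Context d (X : measurableType d) (R : realType).

Record mp_action (G : groupType) (mu : probability X R) := MPAction {
  mp_act :> G -> X -> X;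
  mp_act1 : forall x, mp_act 1%g x = x;
  mp_actM : forall g h x, mp_act (g * h)%g x = mp_act g (mp_act h x);
  measurable_mp_act : forall g, measurable_fun setT (mp_act g);
  mp_act_preserving : forall g A, measurable A -> mu (mp_act g @^-1` A) = mu A
}.

Context (G : groupType) (mu : probability X R) (sigma : mp_action G mu).

HB.instance Definition _ g :=
  isMeasurableFun.Build _ _ _ _ (sigma g) (measurable_mp_act sigma g).

Definition unitary_act (g : G) (u : unitary mu) : unitary mu :=
  to_unitary mu (repr u \o sigma g^-1%g).

Lemma unitary_actE g (f : {mfun X >-> circle R}) :
  unitary_act g (to_unitary mu f) = to_unitary mu (f \o sigma g^-1%g).
Proof.
apply/unitary_eqP; have [N [mN N0 fN]] := repr_to_unitary mu f.
exists (sigma g^-1%g @^-1` N); split.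
- by rewrite -[_ @^-1` _]setTI; exact: measurable_mp_act.
- by rewrite mp_act_preserving.
- by move=> x /= h; apply: fN => /= h'; apply: h => _; exact: h'.
Qed.

Lemma unitary_actM g (u v : unitary mu) :
  unitary_act g (u * v)%g = (unitary_act g u * unitary_act g v)%g.
Proof.
elim/unitary_ind: u => f; elim/unitary_ind: v => h.
rewrite [(_ * _)%g in LHS]unitary_mulE !unitary_actE.
by rewrite [RHS]unitary_mulE; apply/unitary_eqP; exact: aeW.
Qed.

Lemma unitary_act_one g : unitary_act g 1%g = 1%g.
Proof. by rewrite [LHS]unitary_actE; apply/unitary_eqP; exact: aeW. Qed.

Lemma unitary_actV g (u : unitary mu) :
  unitary_act g (u^-1)%g = (unitary_act g u)^-1%g.
Proof.
by apply/esym/mulg1_eq; rewrite -unitary_actM mulgV unitary_act_one.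
Qed.

End measure_preserving_action.

Section cocycles.
Local Open Scope group_scope.
Context d (X : measurableType d) (R : realType) (G : groupType).
Context (mu : probability X R) (sigma : mp_action G mu).

Record cocycle := Cocycle {
  cocycle_fun :> G -> unitary mu;
  cocycleM : forall g h,
    cocycle_fun (g * h) = cocycle_fun g * unitary_act sigma g (cocycle_fun h);
  cocycle1 : cocycle_fun 1 = 1
}.

HB.instance Definition _ := gen_eqMixin cocycle.
HB.instance Definition _ := gen_choiceMixin cocycle.

Lemma cocycle_ext (w w' : cocycle) : w =1 w' -> w = w'.
Proof.
case: w w' => [w wM w1] [w' w'M w'1] /= /funext ww'.
by subst w'; congr Cocycle; exact: Prop_irrelevance.
Qed.

Let unitary_mulgACA (a b c e : unitary mu) : (a * b) * (c * e) = (a * c) * (b * e).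
Proof. by rewrite !mulgA -[a * b * c]mulgA (unitary_mulgC b c) !mulgA. Qed.

Let unitary_invMg (a b : unitary mu) : (a * b)^-1 = a^-1 * b^-1.
Proof. by rewrite invgM unitary_mulgC. Qed.

Definition cocycle_one : cocycle.
Proof.
exists (fun=> 1) => // g h.
by rewrite unitary_act_one mulg1.
Defined.

Definition cocycle_mul (w w' : cocycle) : cocycle.
Proof.
exists (fun g => w g * w' g) => [g h|].
  by rewrite !cocycleM unitary_actM unitary_mulgACA.
by rewrite !cocycle1 mulg1.
Defined.

Definition cocycle_inv (w : cocycle) : cocycle.
Proof.
exists (fun g => (w g)^-1) => [g h|].
  by rewrite cocycleM unitary_actV unitary_invMg.
by rewrite cocycle1 invg1.
Defined.

Let cocycle_mulA : associative cocycle_mul.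
Proof. by move=> u v w; apply: cocycle_ext => g /=; exact: mulgA. Qed.

Let cocycle_mul1 : left_id cocycle_one cocycle_mul.
Proof. by move=> w; apply: cocycle_ext => g /=; exact: mul1g. Qed.

Let cocycle_1mul : right_id cocycle_one cocycle_mul.
Proof. by move=> w; apply: cocycle_ext => g /=; exact: mulg1. Qed.

Let cocycle_mulV : left_inverse cocycle_one cocycle_inv cocycle_mul.
Proof. by move=> w; apply: cocycle_ext => g /=; exact: mulVg. Qed.

Let cocycle_Vmul : right_inverse cocycle_one cocycle_inv cocycle_mul.
Proof. by move=> w; apply: cocycle_ext => g /=; exact: mulgV. Qed.

HB.instance Definition _ := isGroup.Build cocycle
  cocycle_mulA cocycle_mul1 cocycle_1mul cocycle_mulV cocycle_Vmul.

Lemma cocycle_mulgC (w w' : cocycle) : w * w' = w' * w.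
Proof. by apply: cocycle_ext => g; exact: unitary_mulgC. Qed.

(* in the group of unitaries the adjoint is the inverse *)
Definition is_coboundary (w : cocycle) :=
  exists v : unitary mu, forall g, w g = v * unitary_act sigma g v^-1.

Definition cocycle_equivalent (w w' : cocycle) :=
  exists v : unitary mu, forall g, w' g = v * w g * unitary_act sigma g v^-1.

Definition coboundaries : normal_subgroup cocycle.
Proof.
exists is_coboundary.
- by exists 1 => g; rewrite invg1 unitary_act_one mulg1.
- move=> w w' [v wv] [v' wv']; exists (v * v') => g.
  by rewrite [LHS]/= wv wv' unitary_invMg unitary_actM unitary_mulgACA.
- move=> w [v wv]; exists v^-1 => g.
  by rewrite [LHS]/= wv unitary_invMg !unitary_actV.
- by move=> w w' [v wv]; exists v => g; rewrite conjgE cocycle_mulgC mulgK wv.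
Defined.

Definition H1 : groupType := quotient_group coboundaries.

Definition cohomology_class (w : cocycle) : H1 :=
  \pi_(quotient_group coboundaries)%qT w.

Lemma cohomology_classP (w w' : cocycle) :
  cohomology_class w = cohomology_class w' <-> cocycle_equivalent w w'.
Proof.
rewrite /cohomology_class; split.
  move=> /quotient_eqP[v vE]; exists v => g.
  by rewrite (unitary_mulgC v) -mulgA -vE /= mulVKg.
move=> [v vE]; apply/quotient_eqP; exists v => g /=.
by rewrite vE (unitary_mulgC v) -mulgA mulKg.
Qed.

End cocycles.

Section characters.
Local Open Scope group_scope.
Context (R : realType) (G : groupType).

Record character := Character {
  character_fun :> G -> circle R;
  characterM : forall g h,
    character_fun (g * h) = character_fun g * character_fun h
}.

HB.instance Definition _ := gen_eqMixin character.
HB.instance Definition _ := gen_choiceMixin character.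

Lemma character_ext (a b : character) : a =1 b -> a = b.
Proof.
case: a b => [a aM] [b bM] /= /funext ab.
by subst b; congr Character; exact: Prop_irrelevance.
Qed.

Lemma character1 (a : character) : a 1 = 1.
Proof. by apply: (@mulgI _ (a 1)); rewrite -characterM !mulg1. Qed.

Definition character_one : character.
Proof. by exists (fun=> 1) => g h; rewrite mulg1. Defined.

Definition character_mul (a b : character) : character.
Proof.
exists (fun g => a g * b g) => g h; rewrite !characterM !mulgA; congr (_ * _).
by rewrite -!mulgA (circle_mulgC (a h)).
Defined.

Definition character_inv (a : character) : character.
Proof.
by exists (fun g => (a g)^-1) => g h; rewrite characterM invgM circle_mulgC.
Defined.

Let character_mulA : associative character_mul.
Proof. by move=> a b c; apply: character_ext => g /=; exact: mulgA. Qed.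

Let character_mul1 : left_id character_one character_mul.
Proof. by move=> a; apply: character_ext => g /=; exact: mul1g. Qed.

Let character_1mul : right_id character_one character_mul.
Proof. by move=> a; apply: character_ext => g /=; exact: mulg1. Qed.

Let character_mulV : left_inverse character_one character_inv character_mul.
Proof. by move=> a; apply: character_ext => g /=; exact: mulVg. Qed.

Let character_Vmul : right_inverse character_one character_inv character_mul.
Proof. by move=> a; apply: character_ext => g /=; exact: mulgV. Qed.

HB.instance Definition _ := isGroup.Build character
  character_mulA character_mul1 character_1mul character_mulV character_Vmul.

Context d (X : measurableType d) (mu : probability X R).
Variable sigma : mp_action G mu.

Definition character_cocycle (a : character) : cocycle sigma.
Proof.
exists (fun g => to_unitary mu (cst (a g))) => [g h|].
  rewrite unitary_actE [RHS]unitary_mulE; apply/unitary_eqP; apply: aeW => x _.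
  by rewrite /= /circle_funM /= characterM.
by rewrite character1.
Defined.

Definition character_class (a : character) : H1 sigma :=
  cohomology_class (character_cocycle a).

End characters.

Definition pow_display : measure_display -> measure_display.
Proof. exact. Qed.

(* the product of copies of T indexed by I, with the product sigma-algebra *)
Definition pow_space (I T : Type) : Type := I -> T.

Section pow_space.
Context (I : choiceType) d (T : measurableType d).

Definition coordinate_sets : set (set (pow_space I T)) :=
  [set B | exists i (A : set T), measurable A /\ B = [set x | A (x i)]].

HB.instance Definition _ := Pointed.copy (pow_space I T) (I -> T).

Let pow_set0 : <<s coordinate_sets >> set0.
Proof. exact: sigma_algebra0. Qed.

Let pow_setC A : <<s coordinate_sets >> A -> <<s coordinate_sets >> (~` A).
Proof. exact: sigma_algebraC. Qed.

Let pow_bigcup (F : (set (pow_space I T))^nat) :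
  (forall i, <<s coordinate_sets >> (F i)) ->
  <<s coordinate_sets >> (\bigcup_i F i).
Proof. exact: sigma_algebra_bigcup. Qed.

HB.instance Definition _ := isMeasurable.Build (pow_display d) (pow_space I T)
  pow_set0 pow_setC pow_bigcup.

Definition cylinder (s : seq I) (A : I -> set T) : set (pow_space I T) :=
  [set x | forall i, i \in s -> A i (x i)].

Definition cylinders : set (set (pow_space I T)) :=
  [set B | exists s A, (forall i, measurable (A i)) /\ B = cylinder s A].

Lemma measurable_coordinate (i : I) (A : set T) :
  measurable A -> measurable [set x : pow_space I T | A (x i)].
Proof. by move=> mA; apply: sub_sigma_algebra; exists i, A. Qed.

Lemma measurable_cylinder (s : seq I) (A : I -> set T) :
  (forall i, measurable (A i)) -> measurable (cylinder s A).
Proof.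
move=> mA; elim: s => [|i s IHs].
  by rewrite (_ : cylinder _ _ = setT)//; apply/seteqP; split.
rewrite (_ : cylinder _ _ = [set x | A i (x i)] `&` cylinder s A).
  by apply: measurableI => //; exact: measurable_coordinate.
apply/seteqP; split=> [x xA|x [xi xs] j].
  split=> [|j js]; first by apply: xA; rewrite inE eqxx.
  by apply: xA; rewrite inE js orbT.
by rewrite inE => /orP[/eqP->//|]; exact: xs.
Qed.

Lemma measurable_pow_cylinders :
  @measurable _ (pow_space I T) = <<s cylinders >>.
Proof.
apply/seteqP; split.
  apply: smallest_sub; first exact: smallest_sigma_algebra.
  move=> _ [i [A [mA ->]]]; apply: sub_sigma_algebra.
  exists [:: i], (fun=> A); split=> //; apply/seteqP; split=> x.
    by move=> Ax j; rewrite inE => /eqP->.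
  by apply; rewrite inE.
apply: smallest_sub; first exact: sigma_algebra_measurable.
by move=> _ [s [A [mA ->]]]; exact: measurable_cylinder.
Qed.

Lemma cylinders_setI : setI_closed cylinders.
Proof.
move=> _ _ [s [A [mA ->]]] [t [B [mB ->]]].
pose C i := (if i \in s then A i else setT) `&` (if i \in t then B i else setT).
exists (s ++ t), C; split.
  by move=> i; apply: measurableI; case: ifP.
apply/seteqP; split=> [x [xA xB] i _|x xC].
  by split; case: ifP => //; [exact: xA|exact: xB].
split=> i it.
  by have [] := xC i; rewrite ?mem_cat ?it.
by have [] := xC i; rewrite ?mem_cat ?it ?orbT.
Qed.

Context (R : realType).

(* There is at most one such mu, by [product_measure_unique]; its existence for
   every index set is the classical theorem on infinite products of probability
   spaces. *)
Definition is_product_measure (mu0 : probability T R)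
    (mu : probability (pow_space I T) R) :=
  forall (s : seq I) (A : I -> set T), uniq s -> (forall i, measurable (A i)) ->
    mu (cylinder s A) = (\prod_(i <- s) mu0 (A i))%E.

Lemma eq_cylinders (m1 m2 : {measure set (pow_space I T) -> \bar R}) :
  (m1 setT < +oo)%E ->
  (forall (s : seq I) (A : I -> set T), uniq s -> (forall i, measurable (A i)) ->
    m1 (cylinder s A) = m2 (cylinder s A)) ->
  forall A, measurable A -> m1 A = m2 A.
Proof.
move=> m1T m12 A mA.
have undupE s B : cylinder s B = cylinder (undup s) B.
  by apply/seteqP; split=> x xB i; have := xB i; rewrite mem_undup.
have setTE : cylinders setT.
  exists [::], (fun=> setT); split=> //; exact/seteqP.
apply: (measure_unique cylinders (fun=> setT)) => //.
- exact: measurable_pow_cylinders.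
- exact: cylinders_setI.
- by rewrite bigcup_const//; exists 0%N.
- by move=> _ [s [B [mB ->]]]; rewrite undupE; apply: m12 => //; exact: undup_uniq.
Qed.

Lemma product_measure_unique (mu0 : probability T R)
    (mu nu : probability (pow_space I T) R) :
  is_product_measure mu0 mu -> is_product_measure mu0 nu ->
  forall A, measurable A -> mu A = nu A.
Proof.
move=> pmu pnu; apply: eq_cylinders; first by rewrite [X in (X < _)%E](probability_setT mu) ltry.
by move=> s A us mA; exact: etrans (pmu s A us mA) (esym (pnu s A us mA)).
Qed.

End pow_space.

Section bernoulli.
Local Open Scope group_scope.
Context (R : realType) (G : groupType) d (X0 : measurableType d).
Context (mu0 : probability X0 R) (mu : probability (pow_space G X0) R).

Definition shift (g : G) (x : pow_space G X0) : pow_space G X0 :=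
  fun h => x (g^-1 * h).

Lemma measurable_shift g : measurable_fun setT (shift g).
Proof.
apply: (@measurability _ _ _ _ setT (shift g) (@coordinate_sets G d X0)) => //.
move=> _ [_ [h [A [mA ->]]] <-]; rewrite setTI.
exact: (@measurable_coordinate _ _ _ (g^-1 * h)).
Qed.

Hypothesis mu_prod : is_product_measure mu0 mu.

Lemma shift_preserving g (A : set (pow_space G X0)) :
  measurable A -> mu (shift g @^-1` A) = mu A.
Proof.
move=> mA; have ms := measurable_shift g.
pose f : {mfun pow_space G X0 >-> pow_space G X0} := mfun_Sub (mem_set ms).
rewrite -[LHS]/(pushforward mu f A).
apply: eq_cylinders mA => [|s B us mB].
  by rewrite [X in (X < _)%E](probability_setT mu) ltry.
have cylE : shift g @^-1` cylinder s B =
    cylinder [seq g^-1 * i | i <- s] (fun j => B (g * j)).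
  apply/seteqP; split=> [x xB _ /mapP[i si ->]|x xB i si].
    by rewrite mulVKg; exact: xB.
  by have := xB (g^-1 * i); rewrite mulVKg; apply; exact: map_f.
apply: etrans _ (esym (mu_prod us mB)).
apply: (etrans (congr1 mu cylE)); apply: etrans (mu_prod _ _) _.
- by rewrite map_inj_uniq//; exact: mulgI.
- by move=> i; exact: mB.
by rewrite big_map; apply: eq_bigr => i _; rewrite mulVKg.
Qed.

Definition bernoulli_shift : mp_action G mu.
Proof.
exists shift.
- by move=> x; apply/funext => h; rewrite /shift invg1 mul1g.
- by move=> g h x; apply/funext => k; rewrite /shift invgM mulgA.
- exact: measurable_shift.
- exact: shift_preserving.
Defined.

End bernoulli.

(* T is a standard Borel space: its measurable sets are the Borel sets of a
   Polish topology *)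
Definition standard_borel (R : realType) d (T : measurableType d) :=
  exists (P : completePseudoMetricType R) (f : T -> P),
    [/\ hausdorff_space P,
        (exists2 D : set P, countable D & dense D),
        bijective f
      & forall A : set T, measurable A <-> <<s @open P >> (f @` A)].

(* on a standard Borel space: mu is not a point mass *)
Definition nontrivial_probability (R : realType) d (T : measurableType d)
    (mu : probability T R) :=
  exists2 A : set T, measurable A & (0 < mu A < 1)%E.

Section hilbert.
Variable R : realType.

Definition dot_norm (V : lmodType R[i]) (dot : {dot V for Num.conj}) (u : V) : R :=
  Num.sqrt (complex.Re (dot u u)).

Record hilbertSpace := HilbertSpace {
  hilbert_lmod :> lmodType R[i];
  hdot : {dot hilbert_lmod for Num.conj};
  hilbert_complete : forall u : nat -> hilbert_lmod,
    (forall e : R, 0 < e ->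
      exists N, forall m n, (N <= m)%N -> (N <= n)%N ->
        dot_norm hdot (u m - u n) < e) ->
    exists l, dot_norm hdot (u n - l) @[n --> \oo] --> 0
}.

Definition hnorm (V : hilbertSpace) (u : V) : R := dot_norm (hdot V) u.

(* an isometric linear action of a group is by unitary operators, each being
   invertible *)
Record unitary_rep (G : groupType) (V : hilbertSpace) := UnitaryRep {
  urep :> G -> {linear V -> V};
  urep1 : forall u, urep 1%g u = u;
  urepM : forall g h u, urep (g * h)%g u = urep g (urep h u);
  urep_dot : forall g u v, hdot V (urep g u) (urep g v) = hdot V u v
}.

Definition relative_property_T (G : groupType) (H : G -> Prop) :=
  exists (s : seq G) (e : R), 0 < e /\
    forall (V : hilbertSpace) (pi : unitary_rep G V),
      (exists2 xi : V, hnorm xi = 1 &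
        forall g, g \in s -> hnorm (pi g xi - xi) < e) ->
      exists2 eta : V, hnorm eta = 1 & forall h, H h -> pi h eta = eta.

Definition weakly_rigid (G : groupType) :=
  exists H : normal_subgroup G,
    infinite_set [set h | H h] /\ relative_property_T H.

End hilbert.

(* Main.v *)
Require Import Defs.
From HB Require Import structures.
From mathcomp Require Import all_boot all_order all_algebra.
From mathcomp Require Import sesquilinear generic_quotient ring_quotient.
From mathcomp Require Import complex.
From mathcomp Require Import all_classical all_reals all_analysis.
From mathcomp Require Import measurable_realfun ring lra.

Set Implicit Arguments.
Unset Strict Implicit.
Unset Printing Implicit Defensive.

Import Order.TTheory GRing.Theory Num.Theory.
Import numFieldNormedType.Exports.

Local Open Scope classical_set_scope.
Local Open Scope ring_scope.

(** The proof deforms a cocycle [w] into an independent copy of itself. On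
[Z = X * (X * X)] resample the configuration [x] by a configuration [y] at the
sites [g] where a third configuration [s] carries, at [m] sites around [g], a
pattern from a list [P]. Each [resample P] is an equivariant factor map
[Z -> X]; it is [x] when [P] is empty and [y] when [P] contains all patterns, and
adding one pattern to [P] changes few sites, since each pattern is rare for large [m].
Hence the pullbacks of [w] along [resample P] and [resample (b :: P)] are close in [L^2],
so the constant function is almost invariant for the Koopman representation of
[Z] twisted by their quotient. Relative property (T) gives a vector fixed by
[H], whose polar part, [H] being mixing on [Z], is a unitary making the
two pullbacks cohomologous on [H]. Composing the steps, the copies of [w] in the
variables [x] and [y] are cohomologous on [H] through some [u (x, (y, s))].
The cross ratio of [u] is an [H]-invariant function, hence constant, so
[u] splits as a product of a function of [x] and a function of [(y, s)]; this
makes [w] cohomologous to a character on [H]. Normality of [H]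
and mixing then extend the character to all of [G]. *)

(** * The Hilbert space of square integrable complex functions *)

(** If [X0] has atoms, there may be no continuous path of measure-preserving maps [X0 * X0 -> X0]
    joining the two coordinate projections, so the deformation has to be discrete and needs a
    further source of randomness that the group moves along; the configuration [s] is this source.
    The price is a path of [2 ^ m] steps, with [m] dictated by the rigidity constants. This is
    harmless: closeness serves only to obtain a fixed vector, the resulting cohomology on [H] is
    exact, and exact relations compose without loss. What must be uniform is the size of one step.
    Nontriviality gives a set [A0] of measure [p] with [0 < p < 1]; a label reads membership in [A0]
    at [m] distinct sites, so each pattern has probability at most [q ^ m] with
    [q = max(p, 1 - p) < 1], whatever patterns are already listed. One injective sequence [h] in the
    infinite subgroup [H] serves twice: its elements translate [g] to the sites that are read, and
    all mixing and ergodicity statements are made along it. *)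

Section square_integrable.
Context d (Z : measurableType d) (R : realType) (nu : probability Z R).

Let two_ge1 : (1 <= 2%:E :> \bar R)%E. Proof. exact: lee1n. Qed.

Lemma Lfun2_lin a b (f g : Z -> R) :
  f \in Lfun nu 2%:E -> g \in Lfun nu 2%:E ->
  (fun z => a * f z + b * g z) \in Lfun nu 2%:E.
Proof.
move=> fL gL; have [L0 LD] := Lfun_submod_closed nu two_ge1.
have bgL : b *: g \in Lfun nu 2%:E by rewrite -[b *: g]addr0; exact: LD.
exact: LD a f (b *: g) fL bgL.
Qed.

(** Encoded by real and imaginary parts, so that Hölder's inequality, integration and completeness
    reduce to real functions. *)
Definition sqint : {pred Z -> R[i]} := fun f =>
  ((fun z => complex.Re (f z)) \in Lfun nu 2%:E) &&
  ((fun z => complex.Im (f z)) \in Lfun nu 2%:E).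

Lemma sqint_submod_closed : submod_closed sqint.
Proof.
split=> [|a f g /andP[fr fi] /andP[gr gi]].
  have L0 := (Lfun_submod_closed nu two_ge1).1.
  by apply/andP; split; exact: L0.
apply/andP; split.
  rewrite (_ : (fun z => _) = fun z => 1 * (complex.Re a * complex.Re (f z) +
      - complex.Im a * complex.Im (f z)) + 1 * complex.Re (g z)).
    by apply: Lfun2_lin => //; exact: Lfun2_lin.
  apply/funext => z; rewrite !mul1r mulNr.
  rewrite /GRing.add /= /GRing.scale /=.
  by case: a (f z) (g z) => [a b] [a' b'] [a'' b''].
rewrite (_ : (fun z => _) = fun z => 1 * (complex.Re a * complex.Im (f z) +
     complex.Im a * complex.Re (f z)) + 1 * complex.Im (g z)).
  by apply: Lfun2_lin => //; exact: Lfun2_lin.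
apply/funext => z; rewrite !mul1r.
rewrite /GRing.add /= /GRing.scale /=.
by case: a (f z) (g z) => [a b] [a' b'] [a'' b''].
Qed.

HB.instance Definition _ :=
  GRing.isSubmodClosed.Build R[i] (Z -> R[i]) sqint sqint_submod_closed.

Definition sqint_fun : Type := {f : Z -> R[i] | f \in sqint}.
HB.instance Definition _ := [isSub of sqint_fun for @sval _ _].
HB.instance Definition _ := [Choice of sqint_fun by <:].
HB.instance Definition _ := [SubChoice_isSubLmodule of sqint_fun by <:].

Definition nullfun : {pred sqint_fun} :=
  fun f => `[< val f = (0 : Z -> R[i]) %[ae nu] >].

Lemma nullfun_zmod_closed : zmod_closed nullfun.
Proof.
split=> [|f g /asboolP f0 /asboolP g0]; first by apply/asboolP; apply: aeW.
apply/asboolP; apply: filterS2 f0 g0 => z /= fz gz zT.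
change (sval f z - sval g z = 0).
by rewrite fz// gz// subr0.
Qed.

HB.instance Definition _ :=
  GRing.isZmodClosed.Build sqint_fun nullfun nullfun_zmod_closed.

Definition L2 : Type := Quotient.quot nullfun.
HB.instance Definition _ := GRing.Zmodule.on L2.
HB.instance Definition _ := EqQuotient.on L2.

Definition toL2 (f : sqint_fun) : L2 := (\pi_L2 f)%qT.

Lemma toL2_eqP (f g : sqint_fun) :
  toL2 f = toL2 g <-> {ae nu, forall z, sval f z = sval g z}.
Proof.
split=> [/eqmodP/asboolP|] fg.
  apply: filterS fg => z /(_ I) /eqP.
  by rewrite -[X in X == _]/(sval f z - sval g z) subr_eq0 => /eqP.
apply/eqmodP/asboolP; apply: filterS fg => z fgz _.
by rewrite -[LHS]/(sval f z - sval g z) fgz subrr.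
Qed.

Lemma L2_ind (P : L2 -> Prop) : (forall f, P (toL2 f)) -> forall u, P u.
Proof. by move=> Pf u; rewrite -[u]reprK; exact: Pf. Qed.

Lemma repr_toL2 (f : sqint_fun) :
  {ae nu, forall z, sval (repr (toL2 f)) z = sval f z}.
Proof. by apply/toL2_eqP; rewrite /toL2 reprK. Qed.

Lemma toL2D (f g : sqint_fun) : toL2 (f + g) = toL2 f + toL2 g.
Proof. exact: Quotient.pi_add. Qed.

Definition L2_scale (a : R[i]) (u : L2) : L2 := toL2 (a *: repr u).

Lemma L2_scaleE a f : L2_scale a (toL2 f) = toL2 (a *: f).
Proof.
apply/toL2_eqP; apply: filterS (repr_toL2 f) => z fz.
by rewrite -[RHS]/(a * sval f z) -fz.
Qed.

Let L2_scaleA a b v : L2_scale a (L2_scale b v) = L2_scale (a * b) v.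
Proof. by elim/L2_ind: v => f; rewrite !L2_scaleE scalerA. Qed.

Let L2_scale1 : left_id 1 L2_scale.
Proof. by elim/L2_ind => f; rewrite L2_scaleE scale1r. Qed.

Let L2_scaleDr : right_distributive L2_scale +%R.
Proof.
by move=> a; elim/L2_ind => f; elim/L2_ind => g;
  rewrite !L2_scaleE -!toL2D L2_scaleE scalerDr.
Qed.

Let L2_scaleDl v : {morph L2_scale^~ v : a b / a + b}.
Proof.
by move=> a b /=; elim/L2_ind: v => f; rewrite !L2_scaleE -toL2D scalerDl.
Qed.

HB.instance Definition _ := GRing.Zmodule_isLmodule.Build R[i] L2
  L2_scaleA L2_scale1 L2_scaleDr L2_scaleDl.

Lemma toL2_lin a (f g : sqint_fun) :
  toL2 (a *: f + g) = a *: toL2 f + toL2 g.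
Proof. by rewrite toL2D; congr (_ + _); rewrite -L2_scaleE. Qed.

Definition Cintegrable (f : Z -> R[i]) :=
  nu.-integrable setT (EFin \o (fun z => complex.Re (f z))) /\
  nu.-integrable setT (EFin \o (fun z => complex.Im (f z))).

Definition Cint (f : Z -> R[i]) : R[i] :=
  Complex (\int[nu]_z complex.Re (f z)) (\int[nu]_z complex.Im (f z)).

Let int_lin (a b c : R) (f g h : Z -> R) :
  nu.-integrable setT (EFin \o f) ->
  nu.-integrable setT (EFin \o g) ->
  nu.-integrable setT (EFin \o h) ->
  \int[nu]_z (a * f z + b * g z + c * h z) =
    a * \int[nu]_z f z + b * \int[nu]_z g z + c * \int[nu]_z h z.
Proof.
have iZ k u : nu.-integrable setT (EFin \o u) ->
    nu.-integrable setT (EFin \o (fun z => k * u z)).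
  by move=> iu; apply: (integrableZl measurableT k iu).
have iD u v : nu.-integrable setT (EFin \o u) ->
    nu.-integrable setT (EFin \o v) ->
    nu.-integrable setT (EFin \o (fun z => u z + v z)).
  by move=> iu iv; apply: (integrableD measurableT iu iv).
move=> fi gi hi.
rewrite RintegralD//; [|by apply: iD; exact: iZ|exact: iZ].
rewrite RintegralD//; [|exact: iZ|exact: iZ].
by rewrite !RintegralZl.
Qed.

Lemma Cint_lin a (f g : Z -> R[i]) : Cintegrable f -> Cintegrable g ->
  Cint (fun z => a * f z + g z) = a * Cint f + Cint g.
Proof.
move=> [fr fi] [gr gi]; rewrite /Cint.
have -> : (fun z => complex.Re (a * f z + g z)) = fun z =>
    complex.Re a * complex.Re (f z) + (- complex.Im a) * complex.Im (f z)
    + 1 * complex.Re (g z).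
  apply/funext => z; rewrite mul1r mulNr.
  by case: a (f z) (g z) => [a b] [a' b'] [a'' b''].
have -> : (fun z => complex.Im (a * f z + g z)) = fun z =>
    complex.Re a * complex.Im (f z) + complex.Im a * complex.Re (f z)
    + 1 * complex.Im (g z).
  apply/funext => z; rewrite mul1r.
  by case: a (f z) (g z) => [a b] [a' b'] [a'' b''].
rewrite !int_lin// !mul1r mulNr.
by case: a.
Qed.

Lemma Cint_conj (f : Z -> R[i]) : Cintegrable f ->
  Cint (fun z => Num.conj (f z)) = Num.conj (Cint f).
Proof.
move=> [fr fi]; rewrite /Cint.
have -> : (fun z => complex.Re (Num.conj (f z))) = fun z => complex.Re (f z).
  by apply/funext => z; case: (f z).
have -> : (fun z => complex.Im (Num.conj (f z))) = fun z => -1 * complex.Im (f z).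
  by apply/funext => z; rewrite mulN1r; case: (f z).
by rewrite RintegralZl// mulN1r.
Qed.

Lemma ae_eq_Cint (f g : Z -> R[i]) :
  measurable_fun setT (fun z => complex.Re (f z)) ->
  measurable_fun setT (fun z => complex.Im (f z)) ->
  measurable_fun setT (fun z => complex.Re (g z)) ->
  measurable_fun setT (fun z => complex.Im (g z)) ->
  {ae nu, forall z, f z = g z} -> Cint f = Cint g.
Proof.
move=> fr fi gr gi fg; rewrite /Cint; congr Complex; congr fine;
  (apply: ae_eq_integral => //; [exact/measurable_EFinP|exact/measurable_EFinP|]);
  by apply: filterS fg => z ->.
Qed.

End square_integrable.

Section dot.
Context d (Z : measurableType d) (R : realType) (nu : probability Z R).
Local Notation sqf := (sqint_fun nu).
Local Notation V := (L2 nu).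

Lemma toL20 : toL2 (0 : sqf) = 0.
Proof. by apply: (addIr (toL2 (0 : sqf))); rewrite -toL2D !add0r. Qed.

Lemma sqint_Re (f : sqf) : (fun z => complex.Re (sval f z)) \in Lfun nu 2%:E.
Proof. by case: f => f /= /andP[]. Qed.

Lemma sqint_Im (f : sqf) : (fun z => complex.Im (sval f z)) \in Lfun nu 2%:E.
Proof. by case: f => f /= /andP[]. Qed.

Lemma Lfun_measurable p (f : Z -> R) : f \in Lfun nu p -> measurable_fun setT f.
Proof. by rewrite inE => /andP[/[!inE]]. Qed.

Lemma measurable_Re (f : sqf) :
  measurable_fun setT (fun z => complex.Re (sval f z)).
Proof. exact/Lfun_measurable/sqint_Re. Qed.

Lemma measurable_Im (f : sqf) :
  measurable_fun setT (fun z => complex.Im (sval f z)).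
Proof. exact/Lfun_measurable/sqint_Im. Qed.

Let Re_mulJ (x y : R[i]) : complex.Re (x * Num.conj y) =
  complex.Re x * complex.Re y + complex.Im x * complex.Im y.
Proof. by case: x y => [a b] [c e] /=; rewrite mulrN opprK. Qed.

Let Im_mulJ (x y : R[i]) : complex.Im (x * Num.conj y) =
  complex.Im x * complex.Re y - complex.Re x * complex.Im y.
Proof. by case: x y => [a b] [c e] /=; rewrite mulrN addrC. Qed.

Lemma Lfun2_mul_integrable (f g : Z -> R) :
  f \in Lfun nu 2%:E -> g \in Lfun nu 2%:E ->
  nu.-integrable setT (EFin \o (fun z => f z * g z)).
Proof. by move=> fL gL; exact/Lfun1_integrable/Lfun2_mul_Lfun1. Qed.

Lemma sqint_mulJ (f g : sqf) :
  Cintegrable nu (fun z => sval f z * Num.conj (sval g z)).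
Proof.
have [fr fi] := (sqint_Re f, sqint_Im f).
have [gr gi] := (sqint_Re g, sqint_Im g).
split.
  under eq_fun do rewrite Re_mulJ.
  exact: (integrableD measurableT (Lfun2_mul_integrable fr gr)
                                  (Lfun2_mul_integrable fi gi)).
under eq_fun do rewrite Im_mulJ.
exact: (integrableB measurableT (Lfun2_mul_integrable fi gr)
                                (Lfun2_mul_integrable fr gi)).
Qed.

Definition L2_dot (u v : V) : R[i] :=
  Cint nu (fun z => sval (repr u) z * Num.conj (sval (repr v) z)).

Lemma Cintegrable_measurable (f : Z -> R[i]) : Cintegrable nu f ->
  measurable_fun setT (fun z => complex.Re (f z)) /\
  measurable_fun setT (fun z => complex.Im (f z)).
Proof. by move=> [/measurable_int/measurable_EFinP ? /measurable_int/measurable_EFinP]. Qed.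

Lemma L2_dotE (f g : sqf) : L2_dot (toL2 f) (toL2 g) =
  Cint nu (fun z => sval f z * Num.conj (sval g z)).
Proof.
have [? ?] := Cintegrable_measurable (sqint_mulJ f g).
have [? ?] := Cintegrable_measurable
  (sqint_mulJ (repr (toL2 f)) (repr (toL2 g))).
apply: ae_eq_Cint => //.
by apply: filterS2 (repr_toL2 f) (repr_toL2 g) => z -> ->.
Qed.

Let L2_dotC u v : L2_dot u v = Num.conj (L2_dot v u).
Proof.
elim/L2_ind: u => f; elim/L2_ind: v => g; rewrite !L2_dotE.
rewrite -Cint_conj; last exact: sqint_mulJ.
by congr Cint; apply/funext => z; rewrite rmorphM /= conjCK mulrC.
Qed.

Let L2_dot_linl a u u' v : L2_dot (a *: u + u') v = a * L2_dot u v + L2_dot u' v.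
Proof.
elim/L2_ind: u => f; elim/L2_ind: u' => f'; elim/L2_ind: v => g.
rewrite -toL2_lin !L2_dotE -Cint_lin; [|exact: sqint_mulJ..].
congr Cint; apply/funext => z.
rewrite -[sval _ z in LHS]/(a * sval f z + sval f' z).
by rewrite mulrDl mulrA.
Qed.

Let L2_dot_bilinear : bilinear_for
  ( *%R : GRing.Scale.law _ _) (Num.conj \; *%R : GRing.Scale.law _ _) L2_dot.
Proof.
split=> [v a u u'|u a v v'] /=; first exact: L2_dot_linl.
by rewrite [LHS]L2_dotC L2_dot_linl rmorphD rmorphM /= -!L2_dotC.
Qed.

HB.instance Definition _ := bilinear_isBilinear.Build
  R[i] V V R[i] _ _ L2_dot L2_dot_bilinear.

HB.instance Definition _ := isHermitianSesquilinear.Build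
  R[i] V false (Num.conj : R[i] -> R[i]) L2_dot
  (fun u v => etrans (L2_dotC u v) (esym (mul1r _))).

Definition normsq (f : Z -> R[i]) : R :=
  \int[nu]_z (complex.Re (f z) ^+ 2 + complex.Im (f z) ^+ 2).

Lemma Cint_normsq (f : Z -> R[i]) :
  Cint nu (fun z => f z * Num.conj (f z)) = Complex (normsq f) 0.
Proof.
rewrite /Cint /normsq; congr Complex.
  by congr fine; apply: eq_integral => z _; rewrite Re_mulJ !expr2.
under eq_Rintegral do rewrite Im_mulJ mulrC subrr.
by rewrite Rintegral_cst// mul0r.
Qed.

Lemma normsq_integrable (f : sqf) : nu.-integrable setT
  (EFin \o (fun z => complex.Re (sval f z) ^+ 2 + complex.Im (sval f z) ^+ 2)).
Proof.
exact: (integrableD measurableT (Lfun2_integrable_sqr (sqint_Re f))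
                                (Lfun2_integrable_sqr (sqint_Im f))).
Qed.

Lemma normsq_ge0 (f : Z -> R[i]) : 0 <= normsq f.
Proof. by apply: Rintegral_ge0 => z _; rewrite addr_ge0// sqr_ge0. Qed.

Lemma normsq_eq0 (f : sqf) : normsq (sval f) = 0 -> toL2 f = 0.
Proof.
move=> f0; rewrite -toL20; apply/toL2_eqP.
have fi := normsq_integrable f.
have /(integrable_fin_num measurableT) int_fin := fi.
have : (\int[nu]_z `|(complex.Re (sval f z) ^+ 2 + complex.Im (sval f z) ^+ 2)%:E| = 0)%E.
  under eq_integral do rewrite gee0_abs ?lee_fin ?addr_ge0 ?sqr_ge0//.
  by rewrite -[LHS]fineK// -/(Rintegral _ _ _) -/(normsq _) f0.
move/(ae_eq_integral_abs nu measurableT (measurable_int _ fi)).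
apply: filterS => z /(_ I) [] /eqP; rewrite paddr_eq0 ?sqr_ge0// !sqrf_eq0.
move=> /andP[/eqP fr /eqP fi0].
by case: (sval f z) fr fi0 => a b /= -> ->.
Qed.

Let L2_dot_gt0 u : u != 0 -> 0 < L2_dot u u.
Proof.
elim/L2_ind: u => f f0; rewrite L2_dotE Cint_normsq ltcE /= eqxx /=.
rewrite lt_def normsq_ge0 andbT; apply: contraNneq f0 => f0.
exact/eqP/normsq_eq0.
Qed.

HB.instance Definition _ := isDotProduct.Build R[i] V L2_dot L2_dot_gt0.

Definition L2dot : {dot V for Num.conj} := L2_dot.

Lemma dot_normE (f : sqf) :
  dot_norm L2dot (toL2 f) = Num.sqrt (normsq (sval f)).
Proof.
rewrite /dot_norm; congr (Num.sqrt _).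
by rewrite -[normsq _]/(complex.Re (Complex (normsq (sval f)) 0)) -Cint_normsq -L2_dotE.
Qed.

End dot.

(** * Completeness of square integrable functions *)

Section Lfun2_complete.
Context d (Z : measurableType d) (R : realType) (nu : probability Z R).
Local Open Scope ereal_scope.

Lemma Lfun2_sqr (h : Z -> R) : measurable_fun setT h ->
  \int[nu]_z (h z ^+ 2)%:E < +oo -> h \in Lfun nu 2%:E.
Proof.
move=> mh hoo; rewrite inE; apply/andP; split; rewrite inE//=.
rewrite /finite_norm unlock poweR_lty//.
rewrite (le_lt_trans _ hoo)// le_eqVlt; apply/orP; left; apply/eqP.
apply: eq_integral => z _ /=.
by rewrite powR_mulrn// real_normK// num_real.
Qed.

Let amgm (t x : R) : (0 < t -> `|x| <= t * x ^+ 2 + t^-1)%R.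
Proof.
move=> t0; have -> : (x ^+ 2 = `|x| ^+ 2)%R by rewrite real_normK// num_real.
set y := `|x|%R; have y0 : (0 <= y)%R by rewrite /y.
rewrite -(ler_pM2r t0) mulrDl mulVf ?gt_eqF//.
by nra.
Qed.

(** The general term is [2 ^ j * 4 ^ -j + 2 ^ -j], the bound that [amgm] produces below; the sum is
    4. *)
Let half_pow_summable : \sum_(0 <= j <oo) (2%:E * ((2^-1) ^+ j)%:E : \bar R) < +oo.
Proof.
apply: (@le_lt_trans _ _ (4%:E)); last exact: ltry.
apply: lime_le.
  by apply: is_cvg_nneseries => j _ _; rewrite -EFinM lee_fin mulr_ge0// exprn_ge0// invr_ge0.
apply: nearW => n.
under eq_bigr do rewrite -EFinM.
rewrite sumEFin lee_fin.
have := @geometric_le_lim R n 2 2^-1.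
rewrite ler0n invr_gt0 ltr0n ger0_norm ?invr_ge0// invf_lt1// ltr1n => /(_ isT isT isT).
by rewrite /series /geometric /= (_ : 2 / (1 - 2^-1) = 4 :> R)%R//; field.
Qed.

(* [amgm] with [t = 2 ^ j] turns the [L^2] bound into a summable [L^1] bound. *)
Lemma Lfun2_subseq (u : nat -> Z -> R) :
  (forall n, measurable_fun setT (u n)) ->
  (forall j, \int[nu]_z ((u j.+1 z - u j z) ^+ 2)%:E <= (4^-1 ^+ j)%:E) ->
  {ae nu, forall z, exists l : R, u n z @[n --> \oo] --> l}.
Proof.
move=> mu4 u4.
have md j : measurable_fun setT (fun z => (`|u j.+1 z - u j z|)%:E).
  by apply/measurable_EFinP; apply: measurableT_comp => //; exact: measurable_funB.
pose G z := \sum_(0 <= j <oo) (`|u j.+1 z - u j z|)%:E.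
have mG : measurable_fun setT G.
  by apply: ge0_emeasurable_sum.
have Goo : \int[nu]_z G z < +oo.
  rewrite integral_nneseries//.
  apply: le_lt_trans half_pow_summable; apply: lee_nneseries => [j _ _|j _].
    exact: integral_ge0.
  have t0 : (0 < (2:R) ^+ j)%R by rewrite exprn_gt0.
  apply: (@le_trans _ _
      (\int[nu]_z ((2 ^+ j * (u j.+1 z - u j z) ^+ 2)%:E + ((2 ^+ j)^-1)%:E))).
    apply: ge0_le_integral => //.
      apply: emeasurable_funD => //; apply/measurable_EFinP.
      apply: measurable_funM => //; apply: measurable_funX.
      exact: measurable_funB.
    by move=> z _; rewrite -EFinD lee_fin; exact: amgm.
  have msq : measurable_fun setT (fun z => ((u j.+1 z - u j z) ^+ 2)%:E).
    by apply/measurable_EFinP; apply: measurable_funX; exact: measurable_funB.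
  rewrite ge0_integralD//; last 2 first.
    by move=> z _; rewrite lee_fin mulr_ge0 ?sqr_ge0// ltW.
    apply/measurable_EFinP; apply: measurable_funM => //; apply: measurable_funX.
      exact: measurable_funB.
  under eq_integral do rewrite EFinM.
  rewrite ge0_integralZl//; last by move=> z _; rewrite lee_fin sqr_ge0.
  rewrite integral_cst// [X in _ + _ * X](probability_setT nu) mule1.
  rewrite -exprVn (_ : 2%:E = 1 + 1) // muleDl// mul1e leeD2r//.
  apply: (@le_trans _ _ ((2 ^+ j)%:E * (4^-1 ^+ j)%:E)).
    by rewrite lee_pmul2l ?u4// lte_fin.
  rewrite -EFinM lee_fin -exprMn.
  by rewrite (_ : 2 * 4^-1 = 2^-1 :> R)%R//; field.
have iG : nu.-integrable setT G.
  apply/integrableP; split => //.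
  under eq_integral do rewrite gee0_abs ?nneseries_ge0//.
  exact: Goo.
move/integrable_ae : iG => /(_ measurableT); apply: filterS => z /(_ I) Gz.
have : cvgn (series (fun j => u j.+1 z - u j z)%R).
  apply: normed_cvg => /=; apply: nondecreasing_is_cvgn.
    exact: (@nondecreasing_series _ (fun j => `|u j.+1 z - u j z|%R)).
  exists (fine (G z)) => _ [n _ <-].
  rewrite -lee_fin fineK// /series /= -sumEFin.
  exact: nneseries_lim_ge.
move=> /cvg_ex[l ul]; exists (u 0%N z + l)%R.
have -> : u ^~ z = (fun n => u 0%N z + series (telescope (u ^~ z)) n)%R.
  by apply/funext => n; exact: eq_sum_telescope.
by apply: cvgD => //; exact: cvg_cst.
Qed.

Lemma limn_einf_le (v : (\bar R)^nat) (e : \bar R) :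
  (\forall n \near \oo, v n <= e) -> limn_einf v <= e.
Proof.
move=> ve; rewrite limn_einf_lim; apply: lime_le; first exact: is_cvg_einfs.
apply: filterS ve => n vne; apply: le_trans vne.
by apply: ereal_inf_lbound; exists n => /=.
Qed.

(* Riesz-Fischer: a rapidly converging subsequence has an almost everywhere limit,
   which is the [L^2] limit by Fatou's lemma. *)
Lemma Lfun2_complete (f : nat -> Z -> R) : (forall n, f n \in Lfun nu 2%:E) ->
  (forall e : R, (0 < e)%R -> exists N, forall m n, (N <= m)%N -> (N <= n)%N ->
    \int[nu]_z ((f m z - f n z) ^+ 2)%:E < e%:E) ->
  exists2 g, g \in Lfun nu 2%:E &
    forall e : R, (0 < e)%R -> exists N, forall n, (N <= n)%N ->
      \int[nu]_z ((f n z - g z) ^+ 2)%:E <= e%:E.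
Proof.
move=> fL fC.
have mf n : measurable_fun setT (f n).
  by have := fL n; rewrite inE => /andP[/[!inE]].
have p4 j : (0 < (4^-1 : R) ^+ j)%R by rewrite exprn_gt0// invr_gt0.
have [N NP] := choice (fun j => fC _ (p4 j)).
(* [k] is nondecreasing and dominates both [N], which makes consecutive terms of [f \o k] close at
   rate [4 ^ -j], and the identity, which lets the Cauchy condition apply to [f (k j)] for large
   [j]. *)
pose k := fix k j := if j is j'.+1 then (k j' + (N j).+1)%N else N 0%N.
have kN j : (N j <= k j)%N.
  by case: j => // j /=; rewrite (leq_trans (leqnSn _))// leq_addl.
have kS j : (k j <= k j.+1)%N by rewrite /= leq_addr.
have kj j : (j <= k j)%N.
  by elim: j => // j IH /=; rewrite addnS ltnS (leq_trans IH)// leq_addr.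
pose u j := f (k j).
have [] := @Lfun2_subseq u.
- by move=> n; exact: mf.
- by move=> j; apply/ltW/NP => //; exact: leq_trans (kS j).
move=> A [mA A0 uA].
(* The upper limit is measurable without any convergence and agrees with the limit wherever that
   exists; [fine] sends infinite values, met only on a null set, to 0. *)
pose g z := fine (limn_esup (fun n => (u n z)%:E)).
have mg : measurable_fun setT g.
  apply: measurableT_comp => //; apply: measurable_fun_limn_esup => n.
  by apply/measurable_EFinP; exact: mf.
have ug : {ae nu, forall z, u n z @[n --> \oo] --> g z}.
  exists A; split=> // z; apply: contra_notP => Az; apply: contrapT => nug.
  apply: Az; apply: uA => -[l ul]; apply: nug.
  have /cvg_limn_einf_sup[_ E] : (u n z)%:E @[n --> \oo] --> l%:E.
    by apply: cvg_EFin => //; exact: nearW.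
  by rewrite /= /g E.
have msq n (h : Z -> R) : measurable_fun setT h ->
    measurable_fun setT (fun z => ((f n z - h z) ^+ 2)%:E).
  by move=> mh; apply/measurable_EFinP; apply: measurable_funX; exact: measurable_funB.
have fg e : (0 < e)%R -> exists N, forall n, (N <= n)%N ->
    \int[nu]_z ((f n z - g z) ^+ 2)%:E <= e%:E.
  move=> e0; have [M MP] := fC _ e0; exists M => n Mn.
  apply: (@le_trans _ _ (\int[nu]_z limn_einf (fun j => ((f n z - u j z) ^+ 2)%:E))).
    apply: ae_ge0_le_integral => //.
    - by move=> z _; rewrite lee_fin sqr_ge0.
    - exact: msq mg.
    - move=> z _; rewrite limn_einf_lim; apply: lime_ge; first exact: is_cvg_einfs.
      apply: nearW => j; apply: le_ereal_inf_tmp => _ [i _ <-].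
      by rewrite lee_fin sqr_ge0.
    - rewrite /limn_einf; apply: measurableT_comp => //.
      apply: measurable_fun_limn_esup => j; apply: measurableT_comp => //.
      by apply: msq; exact: mf.
    - apply: filterS ug => z ugz _.
      suff /cvg_limn_einf_sup[-> _] : ((f n z - u j z) ^+ 2)%:E @[j --> \oo] -->
          ((f n z - g z) ^+ 2)%:E by [].
      apply: cvg_EFin; first exact: nearW.
      have fu : (f n z - u j z)%R @[j --> \oo] --> (f n z - g z)%R.
        by apply: cvgB => //; exact: cvg_cst.
      exact: (cvgM fu fu).
  apply: le_trans (fatou nu measurableT _ _) _.
  - by move=> j; apply: msq; exact: mf.
  - by move=> j z _; rewrite lee_fin sqr_ge0.
  apply: limn_einf_le; near=> j; apply/ltW/MP => //.
  apply: leq_trans (kj j); near: j; exact: nbhs_infty_ge.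
exists g => //.
have [M MP] := fg 1%R ltr01.
have : (fun z => f M z - g z)%R \in Lfun nu 2%:E.
  apply: Lfun2_sqr; first exact: measurable_funB.
  by apply: le_lt_trans (MP M _) _ => //; rewrite ltry.
move=> fgL; rewrite (_ : g = fun z => (1 * f M z + (-1) * (f M z - g z))%R).
  exact: Lfun2_lin.
by apply/funext => z; ring.
Unshelve. all: by end_near.
Qed.
End Lfun2_complete.

Section hilbert.
Context d (Z : measurableType d) (R : realType) (nu : probability Z R).
Local Notation sqf := (sqint_fun nu).
Local Notation V := (L2 nu).

Lemma normsqE (f : sqf) : (normsq nu (sval f))%:E =
  (\int[nu]_z (complex.Re (sval f z) ^+ 2)%:E +
   \int[nu]_z (complex.Im (sval f z) ^+ 2)%:E)%E.
Proof.
have msq (h : Z -> R) : measurable_fun setT h ->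
    measurable_fun setT (fun z => (h z ^+ 2)%:E).
  by move=> mh; apply/measurable_EFinP; exact: measurable_funX.
rewrite /normsq /Rintegral fineK; last first.
  exact: (integrable_fin_num measurableT (normsq_integrable f)).
under eq_integral do rewrite EFinD.
rewrite ge0_integralD//.
- by move=> z _; rewrite lee_fin sqr_ge0.
- exact/msq/measurable_Re.
- by move=> z _; rewrite lee_fin sqr_ge0.
- exact/msq/measurable_Im.
Qed.

Lemma L2_complete (u : nat -> V) :
  (forall e : R, 0 < e ->
      exists N, forall m n, (N <= m)%N -> (N <= n)%N ->
        dot_norm (L2dot nu) (u m - u n) < e) ->
    exists l, dot_norm (L2dot nu) (u n - l) @[n --> \oo] --> 0.
Proof.
move=> uC; pose f n : sqf := repr (u n).
have uE n : u n = toL2 (f n) by rewrite /toL2 reprK.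
have BE (a b : sqf) : toL2 a - toL2 b = toL2 (a - b).
  by apply/eqP; rewrite subr_eq -toL2D subrK.
have ReB (a b : sqf) z : complex.Re (sval (a - b) z) =
    complex.Re (sval a z) - complex.Re (sval b z).
  by rewrite -[sval (a - b) z]/(sval a z - sval b z); case: (sval a z) (sval b z) => ? ? [].
have ImB (a b : sqf) z : complex.Im (sval (a - b) z) =
    complex.Im (sval a z) - complex.Im (sval b z).
  by rewrite -[sval (a - b) z]/(sval a z - sval b z); case: (sval a z) (sval b z) => ? ? [].
have nE (a b : sqf) : (normsq nu (sval (a - b)))%:E =
  (\int[nu]_z ((complex.Re (sval a z) - complex.Re (sval b z)) ^+ 2)%:E +
   \int[nu]_z ((complex.Im (sval a z) - complex.Im (sval b z)) ^+ 2)%:E)%E.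
  rewrite normsqE; congr (_ + _)%E; apply: eq_integral => z _.
    by rewrite ReB.
  by rewrite ImB.
have sC e : 0 < e -> exists N, forall m n, (N <= m)%N -> (N <= n)%N ->
    ((normsq nu (sval (f m - f n)))%:E < e%:E)%E.
  move=> e0; have se0 : 0 < Num.sqrt e by rewrite sqrtr_gt0.
  have [N NP] := uC _ se0; exists N => m n Nm Nn.
  have := NP m n Nm Nn; rewrite !uE BE dot_normE.
  by rewrite ltr_sqrt// lte_fin.
have [] := @Lfun2_complete _ Z R nu (fun n z => complex.Re (sval (f n) z)).
- by move=> n; exact: sqint_Re.
- move=> e /sC[N NP]; exists N => m n Nm Nn; apply: le_lt_trans (NP m n Nm Nn).
  by rewrite nE leeDl// integral_ge0// => z _; rewrite lee_fin sqr_ge0.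
move=> g gL gP.
have [] := @Lfun2_complete _ Z R nu (fun n z => complex.Im (sval (f n) z)).
- by move=> n; exact: sqint_Im.
- move=> e /sC[N NP]; exists N => m n Nm Nn; apply: le_lt_trans (NP m n Nm Nn).
  by rewrite nE leeDr// integral_ge0// => z _; rewrite lee_fin sqr_ge0.
move=> h hL hP.
have ghL : (fun z => Complex (g z) (h z)) \in sqint nu by apply/andP; split.
pose gh : sqf := exist (fun f => f \in sqint nu) _ ghL.
exists (toL2 gh); apply/cvgrPdist_le => e e0.
(* The squared norm is the sum of the contributions of the real and imaginary parts, each allowed
   [e ^+ 2 / 2]. *)
have e20 : 0 < e ^+ 2 / 2 by rewrite divr_gt0// exprn_gt0.
have [N1 N1P] := gP _ e20; have [N2 N2P] := hP _ e20.
near=> n; rewrite sub0r normrN uE BE dot_normE ger0_norm ?sqrtr_ge0//.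
rewrite -[leRHS](ger0_norm (ltW e0)) -sqrtr_sqr ler_sqrt ?sqr_ge0//.
rewrite -lee_fin nE [e ^+ 2]splitr EFinD; apply: leeD.
  by apply: N1P; near: n; exact: nbhs_infty_ge.
by apply: N2P; near: n; exact: nbhs_infty_ge.
Unshelve. all: by end_near.
Qed.

Definition L2_hilbert : hilbertSpace R := HilbertSpace L2_complete.

Lemma hnorm_toL2 (f : sqf) :
  hnorm (toL2 f : L2_hilbert) = Num.sqrt (normsq nu (sval f)).
Proof. exact: dot_normE. Qed.

End hilbert.

(** * Measure-preserving maps and twisted Koopman representations *)

Section measure_preserving.
Context d d' (W : measurableType d) (X : measurableType d') (R : realType).
Context (P : probability W R) (mu : probability X R).

Definition mpres (phi : W -> X) :=
  measurable_fun setT phi /\ forall A, measurable A -> P (phi @^-1` A) = mu A.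

Context (phi : W -> X) (mp : mpres phi).

Lemma mpres_measurable A : measurable A -> measurable (phi @^-1` A).
Proof. by move=> mA; rewrite -[_ @^-1` _]setTI; exact: mp.1. Qed.

Lemma mpres_ae (Q : X -> Prop) :
  {ae mu, forall x, Q x} -> {ae P, forall z, Q (phi z)}.
Proof.
move=> [N [mN N0 QN]]; exists (phi @^-1` N); split.
- by rewrite -[_ @^-1` _]setTI; exact: mp.1.
- by rewrite mp.2.
- by move=> z /= nQ; exact: QN.
Qed.

Lemma mpres_ge0_integral (f : X -> \bar R) : measurable_fun setT f ->
  (forall x, 0 <= f x)%E -> (\int[P]_z f (phi z) = \int[mu]_x f x)%E.
Proof.
move=> mf f0; rewrite -[LHS]/(\int[P]_(z in phi @^-1` setT) (f \o phi) z)%E.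
rewrite -(ge0_integral_pushforward mp.1)//.
apply: eq_measure_integral => [|mphi A mA _]; first exact: mp.1.
  exact: mp.2.
Qed.

Lemma mpres_integrable (f : X -> R) : mu.-integrable setT (EFin \o f) ->
  P.-integrable setT (EFin \o (f \o phi)).
Proof.
move=> /integrableP[mf foo]; apply/integrableP; split.
  apply/measurable_EFinP; apply: measurableT_comp; last exact: mp.1.
  exact/measurable_EFinP.
rewrite (mpres_ge0_integral (f := fun x => `|(f x)%:E|%E))//.
exact: measurableT_comp.
Qed.

Lemma mpres_Rintegral (f : X -> R) : mu.-integrable setT (EFin \o f) ->
  \int[P]_z f (phi z) = \int[mu]_x f x.
Proof.
move=> fi; congr fine.
rewrite -[LHS]/(\int[P]_(z in phi @^-1` setT) ((EFin \o f) \o phi) z)%E.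
rewrite -(integral_pushforward mp.1)//.
- apply: eq_measure_integral => [|mphi A mA _]; first exact: mp.1.
  exact: mp.2.
- exact: measurable_int fi.
- exact: mpres_integrable.
Qed.

End measure_preserving.

Lemma mpres_comp d1 d2 d3 (X1 : measurableType d1) (X2 : measurableType d2)
    (X3 : measurableType d3) (R : realType) (m1 : probability X1 R)
    (m2 : probability X2 R) (m3 : probability X3 R) (f : X1 -> X2) (g : X2 -> X3) :
  mpres m1 m2 f -> mpres m2 m3 g -> mpres m1 m3 (g \o f).
Proof.
move=> [mf fE] [mg gE]; split; first exact: measurableT_comp.
move=> A mA; rewrite -gE// -fE//.
by rewrite -[_ @^-1` _]setTI; exact: mg.
Qed.

Lemma mpres_act d (X : measurableType d) (R : realType) (mu : probability X R)
    (G : groupType) (a : mp_action G mu) g : mpres mu mu (a g).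
Proof. by split; [exact: measurable_mp_act|exact: mp_act_preserving]. Qed.

Section circle_facts.
Variable R : realType.
Implicit Types a b : circle R.

Lemma circle_conj a : Num.conj (val a) = val (a^-1)%g.
Proof. by rewrite circle_valVE; case: (val a). Qed.

Lemma circle_mulJ a : val a * Num.conj (val a) = 1.
Proof. by rewrite circle_conj -circle_valM mulgV. Qed.

Lemma circle_sqr a : complex.Re (val a) ^+ 2 + complex.Im (val a) ^+ 2 = 1.
Proof.
apply: (@complexI R); rewrite add_Re2_Im2.
by rewrite (eqP (valP a)) expr1n.
Qed.

End circle_facts.

Section twisted_koopman.
Context d (Z : measurableType d) (R : realType) (nu : probability Z R).
Context (G : groupType) (zeta : mp_action G nu) (kappa : cocycle zeta).
Local Notation sqf := (sqint_fun nu).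
Local Notation V := (L2_hilbert nu).

Lemma sqintP (f : Z -> R[i]) :
  measurable_fun setT (fun z => complex.Re (f z)) ->
  measurable_fun setT (fun z => complex.Im (f z)) ->
  (\int[nu]_z (complex.Re (f z) ^+ 2 + complex.Im (f z) ^+ 2)%:E < +oo)%E ->
  f \in sqint nu.
Proof.
move=> mr mi foo.
have msq (h : Z -> R) : measurable_fun setT h ->
    measurable_fun setT (fun z => (h z ^+ 2)%:E).
  by move=> mh; apply/measurable_EFinP; exact: measurable_funX.
have mrr := msq _ mr; have mii := msq _ mi.
have mri : measurable_fun setT
    (fun z => (complex.Re (f z) ^+ 2 + complex.Im (f z) ^+ 2)%:E).
  by under eq_fun do rewrite EFinD; exact: emeasurable_funD.
apply/andP; split; apply: Lfun2_sqr => //; apply: le_lt_trans foo;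
  apply: ge0_le_integral => //.
- by move=> z _; rewrite lee_fin sqr_ge0.
- by move=> z _; rewrite lee_fin lerDl sqr_ge0.
- by move=> z _; rewrite lee_fin sqr_ge0.
- by move=> z _; rewrite lee_fin lerDr sqr_ge0.
Qed.

(** The Koopman operator of [g] multiplied by [c], a representative of [kappa g]. The cocycle
    identity makes it multiplicative in [g], and unimodularity of [c] makes it isometric. A
    unimodular fixed function is the same thing as a transfer function writing [kappa] as a
    coboundary. *)
Definition twist (c : {mfun Z >-> circle R}) (g : G) (f : Z -> R[i]) z : R[i] :=
  val (c z) * f (zeta g^-1%g z).

Lemma twist_sqint c g (f : sqf) : twist c g (sval f) \in sqint nu.
Proof.
have [cr ci] := (measurable_circleP c).1 (@measurable_funPT _ _ _ _ c).
have [mz zE] := mpres_act zeta g^-1%g.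
have mr := measurableT_comp (measurable_Re f) mz.
have mi := measurableT_comp (measurable_Im f) mz.
have RE z : complex.Re (twist c g (sval f) z) =
    complex.Re (val (c z)) * complex.Re (sval f (zeta g^-1%g z)) -
    complex.Im (val (c z)) * complex.Im (sval f (zeta g^-1%g z)).
  by rewrite /twist; case: (val (c z)) (sval f _) => [? ?] [].
have IE z : complex.Im (twist c g (sval f) z) =
    complex.Re (val (c z)) * complex.Im (sval f (zeta g^-1%g z)) +
    complex.Im (val (c z)) * complex.Re (sval f (zeta g^-1%g z)).
  by rewrite /twist; case: (val (c z)) (sval f _) => [? ?] [].
apply: sqintP.
- by under eq_fun do rewrite RE; apply: measurable_funB; exact: measurable_funM.
- by under eq_fun do rewrite IE; apply: measurable_funD; exact: measurable_funM.
pose q z := (complex.Re (sval f z) ^+ 2 + complex.Im (sval f z) ^+ 2)%:E.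
have qi := normsq_integrable f.
rewrite (_ : (\int[nu]_z _)%E = (\int[nu]_z q (zeta g^-1%g z))%E).
  rewrite (mpres_ge0_integral (mpres_act zeta g^-1%g)).
  - exact: (integrable_lty measurableT qi).
  - exact: measurable_int qi.
  - by move=> z; rewrite lee_fin addr_ge0 ?sqr_ge0.
apply: eq_integral => z _; rewrite /q RE IE; congr EFin.
rewrite -[RHS]mul1r -(circle_sqr (c z)); ring.
Qed.

Definition twist_sqf c g (f : sqf) : sqf :=
  exist (fun f => f \in sqint nu) _ (twist_sqint c g f).

Lemma twist_ext (c c' : {mfun Z >-> circle R}) g (f f' : sqf) :
  {ae nu, forall z, c z = c' z} -> {ae nu, forall z, sval f z = sval f' z} ->
  toL2 (twist_sqf c g f) = toL2 (twist_sqf c' g f').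
Proof.
move=> cc' ff'; apply/toL2_eqP.
have := mpres_ae (mpres_act zeta g^-1%g) ff'.
by apply: filterS2 cc' => z /= + ff'z; rewrite /twist => ->; rewrite ff'z.
Qed.

Definition twist_L2 (g : G) (u : V) : V := toL2 (twist_sqf (repr (kappa g)) g (repr u)).

Lemma twist_L2E g (f : sqf) : twist_L2 g (toL2 f) = toL2 (twist_sqf (repr (kappa g)) g f).
Proof. by apply: twist_ext; [exact: aeW|exact: repr_toL2]. Qed.

Lemma twist_linear g : linear (twist_L2 g).
Proof.
move=> a u v; elim/L2_ind: u => f; elim/L2_ind: v => h.
rewrite -toL2_lin !twist_L2E -toL2_lin; apply/toL2_eqP; apply: aeW => z.
rewrite -[RHS]/(a * twist (repr (kappa g)) g (sval f) z + twist (repr (kappa g)) g (sval h) z).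
rewrite -[LHS]/(val (repr (kappa g) z) * (a * sval f (zeta g^-1%g z) + sval h (zeta g^-1%g z))).
by rewrite /twist mulrDr !mulrA [_ * a]mulrC.
Qed.

HB.instance Definition _ g := GRing.isLinear.Build R[i] V V *:%R (twist_L2 g) (twist_linear g).

Lemma cocycle1_ae : {ae nu, forall z, repr (kappa 1%g) z = 1%g}.
Proof.
have /unitary_eqP : to_unitary nu (repr (kappa 1%g)) = to_unitary nu (cst 1%g).
  by rewrite /to_unitary reprK; exact: cocycle1.
by apply: filterS => z /(_ I).
Qed.

Lemma cocycleM_ae g h : {ae nu, forall z, repr (kappa (g * h)%g) z =
   (repr (kappa g) z * repr (kappa h) (zeta g^-1 z))%g}.
Proof.
have /unitary_eqP : to_unitary nu (repr (kappa (g * h)%g)) =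
    to_unitary nu (circle_funM (repr (kappa g)) (repr (kappa h) \o zeta g^-1%g)).
  rewrite -unitary_mulE -unitary_actE /to_unitary !reprK; exact: cocycleM.
by apply: filterS => z /(_ I).
Qed.

Lemma twist1 u : twist_L2 1%g u = u.
Proof.
elim/L2_ind: u => f; rewrite twist_L2E; apply/toL2_eqP.
apply: filterS cocycle1_ae => z k1.
by rewrite /= /twist k1 invg1 mp_act1 mul1r.
Qed.

Lemma twistM g h u : twist_L2 (g * h)%g u = twist_L2 g (twist_L2 h u).
Proof.
elim/L2_ind: u => f; rewrite !twist_L2E; apply/toL2_eqP.
apply: filterS (cocycleM_ae g h) => z k1.
rewrite -[LHS]/(val (repr (kappa (g * h)%g) z) * sval f (zeta (g * h)^-1%g z)).
by rewrite k1 circle_valM invgM mp_actM -mulrA.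
Qed.

Lemma twist_dot g u v : hdot V (twist_L2 g u) (twist_L2 g v) = hdot V u v.
Proof.
elim/L2_ind: u => f; elim/L2_ind: v => h; rewrite !twist_L2E.
rewrite [LHS]L2_dotE [RHS]L2_dotE.
have E z : sval (twist_sqf (repr (kappa g)) g f) z *
    Num.conj (sval (twist_sqf (repr (kappa g)) g h) z) =
   (fun z => sval f z * Num.conj (sval h z)) (zeta g^-1%g z).
  by rewrite /= /twist rmorphM mulrACA circle_mulJ mul1r.
under [in LHS]eq_fun do rewrite E.
have [ir ii] := sqint_mulJ f h.
have mz := mpres_act zeta g^-1%g.
rewrite /Cint; congr Complex; first exact: (mpres_Rintegral mz ir).
exact: (mpres_Rintegral mz ii).
Qed.

Definition twist_rep : unitary_rep G V := UnitaryRep twist1 twistM twist_dot.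

End twisted_koopman.

(** * Couplings and mixing *)

Section pr.
Context d (X : measurableType d) (R : realType) (P : probability X R).
Implicit Types A B : set X.

Definition pr A : R := fine (P A).

Lemma prE A : measurable A -> P A = (pr A)%:E.
Proof. by move=> mA; rewrite /pr fineK// fin_num_measure. Qed.

Lemma pr_ge0 A : 0 <= pr A.
Proof. by rewrite fine_ge0. Qed.

Lemma pr_le A B : measurable A -> measurable B -> A `<=` B -> pr A <= pr B.
Proof.
by move=> mA mB AB; rewrite -lee_fin -!prE//; apply: le_measure; rewrite ?inE.
Qed.

Lemma prT : pr setT = 1.
Proof. by rewrite /pr probability_setT. Qed.

Lemma prD A B : measurable A -> measurable B -> A `<=` B ->
  pr (B `\` A) = pr B - pr A.
Proof.
move=> mA mB AB; apply/eqP; rewrite -eqe EFinB -!prE//; last exact: measurableD.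
rewrite measureD//; last by rewrite -ge0_fin_numE// fin_num_measure.
by rewrite (setIidr AB).
Qed.

Lemma pr_cvg (F : nat -> set X) : (forall i, measurable (F i)) ->
  nondecreasing_seq F -> pr (F i) @[i --> \oo] --> pr (\bigcup_i F i).
Proof.
move=> mF ndF; have mU : measurable (\bigcup_i F i) by exact: bigcup_measurable.
apply: fine_cvg; rewrite -prE//.
exact: nondecreasing_cvg_mu.
Qed.

End pr.

Section coupling.
Context (R : realType) d (W : measurableType d) (P : probability W R).
Context d' (W' : measurableType d') (P' : probability W' R).

Section half.
Context d0 (X : measurableType d0) (mu : probability X R).
Variables (f : nat -> W -> X) (f' : W' -> X).
Hypothesis mpf : forall n, mpres P mu (f n).
Hypothesis mpf' : mpres P' mu f'.
Variables (C : nat -> set W) (C' : set W').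
Hypothesis mC : forall n, measurable (C n).
Hypothesis mC' : measurable C'.
Variable S : set (set X).
Hypothesis SE : @measurable _ X = <<s S >>.
Hypothesis SI : setI_closed S.
Hypothesis ST : S setT.

Let good A := pr P (f n @^-1` A `&` C n) @[n --> \oo] --> pr P' (f' @^-1` A `&` C').

Let mfC n A : measurable A -> measurable (f n @^-1` A `&` C n).
Proof.
move=> mA; apply: measurableI => //.
by rewrite -[_ @^-1` _]setTI; exact: (mpf n).1.
Qed.

Let mfC' A : measurable A -> measurable (f' @^-1` A `&` C').
Proof.
move=> mA; apply: measurableI => //.
by rewrite -[_ @^-1` _]setTI; exact: mpf'.1.
Qed.

Let prfD n A B : measurable A -> measurable B -> B `<=` A ->
  pr P (f n @^-1` (A `\` B) `&` C n) =
  pr P (f n @^-1` A `&` C n) - pr P (f n @^-1` B `&` C n).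
Proof.
move=> mA mB BA; rewrite -prD; [|exact: mfC..|by apply: setSI => x; exact: BA].
congr pr; apply/seteqP; split=> [x [[Ax Bx] Cx]|x [[Ax Cx] Bx]].
  by split=> // -[].
by split=> //; split=> // Bfx; exact: Bx.
Qed.

Let prfD' A B : measurable A -> measurable B -> B `<=` A ->
  pr P' (f' @^-1` (A `\` B) `&` C') =
  pr P' (f' @^-1` A `&` C') - pr P' (f' @^-1` B `&` C').
Proof.
move=> mA mB BA; rewrite -prD; [|exact: mfC'..|by apply: setSI => x; exact: BA].
congr pr; apply/seteqP; split=> [x [[Ax Bx] Cx]|x [[Ax Cx] Bx]].
  by split=> // -[].
by split=> //; split=> // Bfx; exact: Bx.
Qed.

Let prf_le n A : measurable A -> pr P (f n @^-1` A `&` C n) <= pr mu A.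
Proof.
move=> mA; rewrite /pr -(mpf n).2//; apply: pr_le => //; first exact: mfC.
by rewrite -[_ @^-1` _]setTI; exact: (mpf n).1.
Qed.

Let prf_le' A : measurable A -> pr P' (f' @^-1` A `&` C') <= pr mu A.
Proof.
move=> mA; rewrite /pr -mpf'.2//; apply: pr_le => //; first exact: mfC'.
by rewrite -[_ @^-1` _]setTI; exact: mpf'.1.
Qed.

(** The sets [A] for which convergence holds form a lambda-system. Passing to an increasing union
    exchanges two limits; this is legitimate because [f n] preserves measure, so that the part of
    the union outside [F i] contributes at most its [mu]-measure, uniformly in [n]. *)
Lemma cvg_coupling_half :
  (forall A, S A -> pr P (f n @^-1` A `&` C n) @[n --> \oo] --> pr P' (f' @^-1` A `&` C')) ->
  forall A, measurable A ->
    pr P (f n @^-1` A `&` C n) @[n --> \oo] --> pr P' (f' @^-1` A `&` C').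
Proof.
move=> Sgood A mA.
suff : [set A | measurable A /\ good A] A by case.
have Sm : S `<=` measurable by rewrite SE; exact: sub_sigma_algebra.
move: mA; rewrite {1}SE; apply: lambda_system_subset => //; last first.
  by move=> B SB; split; [exact: Sm|exact: Sgood].
split=> //.
- by split; [exact: measurableT|exact: Sgood].
- move=> B D DB [mB gB] [mD gD]; split; first exact: measurableD.
  rewrite /good prfD'//.
  under eq_fun do rewrite prfD//.
  exact: cvgB.
move=> F ndF gF.
have mF i : measurable (F i) by have [] := gF i.
have mU : measurable (\bigcup_i F i) by exact: bigcup_measurable.
have FU i : F i `<=` \bigcup_i F i by move=> x Fx; exists i.
split=> //; rewrite /good; apply/cvgrPdist_le => e e0.
have e30 : 0 < e / 3 by rewrite divr_gt0.
have /cvgrPdist_le/(_ _ e30)[i _ /(_ i (leqnn i)) Fi] := @pr_cvg _ _ _ mu F mF ndF.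
have dF : pr mu (\bigcup_i F i `\` F i) <= e / 3.
  by rewrite prD//; apply: le_trans Fi; rewrite ler_norm.
have /cvgrPdist_le/(_ _ e30) := (gF i).2.
apply: filterS => n Fn.
have h1 := prfD n mU (mF i) (FU i).
have h2 := prfD' mU (mF i) (FU i).
have mD : measurable (\bigcup_i F i `\` F i) by exact: measurableD.
have := prf_le n mD; have := prf_le' mD.
have := pr_ge0 P (f n @^-1` (\bigcup_i F i `\` F i) `&` C n).
have := pr_ge0 P' (f' @^-1` (\bigcup_i F i `\` F i) `&` C').
move: Fn; rewrite !ler_distl h1 h2 => /andP[].
move: dF; clear.
by move: (pr _ _) (pr _ _) (pr _ _) (pr _ _) (pr _ _) => a b c e' f0 *; apply/andP; split; lra.
Qed.
End half.

End coupling.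

Section coupling.
Context (R : realType) d (W : measurableType d) (P : probability W R).
Context d' (W' : measurableType d') (P' : probability W' R).
Context dX (X : measurableType dX) (mu : probability X R).
Context dY (Y : measurableType dY) (nu : probability Y R).
Variables (f : nat -> W -> X) (f' : W' -> X) (g : nat -> W -> Y) (g' : W' -> Y).
Hypothesis mpf : forall n, mpres P mu (f n).
Hypothesis mpf' : mpres P' mu f'.
Hypothesis mpg : forall n, mpres P nu (g n).
Hypothesis mpg' : mpres P' nu g'.
Variables (S : set (set X)) (T : set (set Y)).
Hypotheses (SE : @measurable _ X = <<s S >>) (SI : setI_closed S) (ST : S setT).
Hypotheses (TE : @measurable _ Y = <<s T >>) (TI : setI_closed T) (TT : T setT).

(* Applied with the product coupling as limit for mixing, and with the diagonal
   coupling as limit for resampling. *)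
Lemma cvg_coupling :
  (forall A B, S A -> T B -> pr P (f n @^-1` A `&` g n @^-1` B) @[n --> \oo] -->
     pr P' (f' @^-1` A `&` g' @^-1` B)) ->
  forall A B, measurable A -> measurable B ->
    pr P (f n @^-1` A `&` g n @^-1` B) @[n --> \oo] -->
     pr P' (f' @^-1` A `&` g' @^-1` B).
Proof.
move=> ST_cvg A B mA mB.
rewrite setIC; under eq_fun do rewrite setIC.
apply: (cvg_coupling_half mpg mpg' _ _ TE) => //.
- by move=> n; exact: (mpres_measurable (mpf n)).
- exact: (mpres_measurable mpf').
move=> {mB}B TB.
have mB : measurable B by rewrite TE; exact: sub_sigma_algebra.
rewrite setIC; under eq_fun do rewrite setIC.
apply: (cvg_coupling_half mpf mpf' _ _ SE) => //.
- by move=> n; exact: (mpres_measurable (mpg n)).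
- exact: (mpres_measurable mpg').
by move=> C SC; exact: ST_cvg.
Qed.
End coupling.

Section product_probability.
Context (R : realType) d1 d2 (X : measurableType d1) (Y : measurableType d2).
Context (mu : probability X R) (nu : probability Y R).

Definition prodP : probability (X * Y)%type R := (mu \x nu)%E.

Lemma prodPE A B : measurable A -> measurable B ->
  prodP (A `*` B) = (mu A * nu B)%E.
Proof. exact: product_measure1E. Qed.

Lemma pr_prodP A B : measurable A -> measurable B ->
  pr prodP (A `*` B) = pr mu A * pr nu B.
Proof. by move=> mA mB; rewrite /pr prodPE// fineM// fin_num_measure. Qed.

Lemma mpres_fst : mpres prodP mu fst.
Proof.
split=> [|A mA]; first exact: measurable_fst.
rewrite (_ : _ @^-1` _ = A `*` setT); last by apply/seteqP; split=> -[] //= ? ? [].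
by rewrite prodPE// [X in (_ * X)%E](probability_setT nu) mule1.
Qed.

Lemma mpres_snd : mpres prodP nu snd.
Proof.
split=> [|A mA]; first exact: measurable_snd.
rewrite (_ : _ @^-1` _ = setT `*` A); last by apply/seteqP; split=> -[] //= ? ? [].
by rewrite prodPE// [X in (X * _)%E](probability_setT mu) mul1e.
Qed.

Definition rectangles : set (set (X * Y)) :=
  [set C | exists A B, [/\ measurable A, measurable B & C = A `*` B]].

Lemma rectanglesE : @measurable _ (X * Y)%type = <<s rectangles >>.
Proof.
rewrite measurable_prod_measurableType; congr (<<s _ >>).
apply/seteqP; split=> [_ [A mA [B mB <-]]|_ [A [B [mA mB ->]]]].
  by exists A, B.
by exists A => //; exists B.
Qed.

Lemma rectanglesI : setI_closed rectangles.
Proof.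
move=> _ _ [A [B [mA mB ->]]] [A' [B' [mA' mB' ->]]].
exists (A `&` A'), (B `&` B'); split; [exact: measurableI..|].
by rewrite setXI.
Qed.

Lemma rectanglesT : rectangles setT.
Proof. by exists setT, setT; split=> //; rewrite setXTT. Qed.

Lemma mpres_prod d (W : measurableType d) (P : probability W R) (f : W -> X * Y) :
  measurable_fun setT f ->
  (forall A B, measurable A -> measurable B -> P (f @^-1` (A `*` B)) = (mu A * nu B)%E) ->
  mpres P prodP f.
Proof.
move=> mf fE; split=> // A mA.
pose f' : {mfun W >-> (X * Y)%type} := mfun_Sub (mem_set mf).
rewrite -[LHS]/(pushforward P f' A); apply/esym.
exact: (product_measure_unique (m1 := mu) (m2 := nu)).
Qed.

End product_probability.

Section mixing.
Context (R : realType).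

(** Stated for a sequence of maps, to be applied to the action of the elements [h n] of the rigid
    subgroup. *)
Definition mixing d (X : measurableType d) (mu : probability X R)
    (tau : nat -> X -> X) :=
  forall A B, measurable A -> measurable B ->
    pr mu (A `&` tau n @^-1` B) @[n --> \oo] --> pr mu A * pr mu B.

(** Mixing means that the couplings [(id, tau n)] converge to the independent coupling [(fst, snd)]
    on the square, so a pi-system suffices. *)
Lemma mixing_pi d (X : measurableType d) (mu : probability X R)
    (tau : nat -> X -> X) (S : set (set X)) :
  (forall n, mpres mu mu (tau n)) ->
  @measurable _ X = <<s S >> -> setI_closed S -> S setT ->
  (forall A B, S A -> S B ->
    pr mu (A `&` tau n @^-1` B) @[n --> \oo] --> pr mu A * pr mu B) ->
  mixing mu tau.
Proof.
move=> mt SE SI ST Scvg A B mA mB.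
have XE C D : measurable C -> measurable D ->
    pr (prodP mu mu) (fst @^-1` C `&` snd @^-1` D) = pr mu C * pr mu D.
  by move=> mC mD; rewrite -pr_prodP.
rewrite -XE//.
apply: (@cvg_coupling _ _ _ _ _ _ _ _ _ mu _ _ mu (fun n => id) fst tau snd _ _ _ _ S S) => //.
- exact: mpres_fst.
- exact: mpres_snd.
move=> C D SC SD.
have Sm : S `<=` measurable by rewrite SE; exact: sub_sigma_algebra.
by rewrite XE; [exact: Scvg|exact: Sm..].
Qed.

Definition prod_map (X Y : Type) (f : X -> X) (g : Y -> Y) (z : X * Y) := (f z.1, g z.2).

Context d1 d2 (X : measurableType d1) (Y : measurableType d2).
Context (mu : probability X R) (nu : probability Y R).

Lemma mpres_prod_map f g : mpres mu mu f -> mpres nu nu g ->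
  mpres (prodP mu nu) (prodP mu nu) (prod_map f g).
Proof.
move=> [mf fE] [mg gE]; apply: mpres_prod.
  apply: measurable_fun_pair; exact: measurableT_comp.
move=> A B mA mB.
rewrite (_ : _ @^-1` _ = (f @^-1` A) `*` (g @^-1` B)) ; last by apply/seteqP; split.
rewrite prodPE ?fE ?gE//.
- by rewrite -[_ @^-1` _]setTI; exact: mf.
- by rewrite -[_ @^-1` _]setTI; exact: mg.
Qed.

Lemma mixing_prod (tau : nat -> X -> X) (theta : nat -> Y -> Y) :
  (forall n, mpres mu mu (tau n)) -> (forall n, mpres nu nu (theta n)) ->
  mixing mu tau -> mixing nu theta ->
  mixing (prodP mu nu) (fun n => prod_map (tau n) (theta n)).
Proof.
move=> mt mh mixt mixh.
apply: (mixing_pi _ (@rectanglesE _ _ X Y)).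
- by move=> n; exact: mpres_prod_map.
- exact: rectanglesI.
- exact: rectanglesT.
move=> _ _ [A [B [mA mB ->]]] [A' [B' [mA' mB' ->]]].
rewrite !pr_prodP// mulrACA.
have E n : pr (prodP mu nu) (A `*` B `&` prod_map (tau n) (theta n) @^-1` (A' `*` B')) =
    pr mu (A `&` tau n @^-1` A') * pr nu (B `&` theta n @^-1` B').
  rewrite -pr_prodP; last 2 first.
  - by apply: measurableI => //; exact: (mpres_measurable (mt n)).
  - by apply: measurableI => //; exact: (mpres_measurable (mh n)).
  by congr pr; apply/seteqP; split=> -[x y] [[? ?] [? ?]].
under eq_fun do rewrite E.
by apply: cvgM; [exact: mixt|exact: mixh].
Qed.
End mixing.

(** * Ergodicity *)

Section ae.
Context (R : realType) d (X : measurableType d) (mu : probability X R).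

Lemma ae_ex (Q : X -> Prop) : {ae mu, forall x, Q x} -> exists x, Q x.
Proof.
move=> [N [mN N0 QN]]; apply: contrapT => /forallNP nQ.
have NT : N = setT by apply/seteqP; split=> // x _; apply: QN; exact: nQ.
by move: N0; rewrite NT => /eqP; rewrite [X in X == _](probability_setT mu) onee_eq0.
Qed.

Lemma ae_eq_pr (A B : set X) : measurable A -> measurable B ->
  {ae mu, forall x, A x <-> B x} -> pr mu A = pr mu B.
Proof.
move=> mA mB [N [mN N0 QN]].
suff le C D : measurable C -> measurable D -> (forall x, ~ N x -> C x -> D x) ->
    (mu C <= mu D)%E.
  congr fine; apply/eqP; rewrite eq_le !le//.
    by move=> x Nx; apply: contrapT => h; apply: Nx; apply: QN => /= h'; tauto.
  by move=> x Nx; apply: contrapT => h; apply: Nx; apply: QN => /= h'; tauto.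
move=> mC mD CD; apply: (@le_trans _ _ (mu (D `|` N))).
  apply: le_measure; rewrite ?inE//; first exact: measurableU.
  move=> x Cx; have [Nx|Nx] := pselect (N x); [by right|left].
  exact: CD.
by rewrite (le_trans (measureU2 _ mD mN))// [X in (_ + X)%E]N0 adde0.
Qed.

Lemma ae_ge0_int0 (g : X -> R) : mu.-integrable setT (EFin \o g) ->
  {ae mu, forall x, 0 <= g x} -> \int[mu]_x g x = 0 -> {ae mu, forall x, g x = 0}.
Proof.
move=> ig g0 int0.
have mg := measurable_int _ ig.
have : (\int[mu]_x `|(EFin \o g) x| = 0)%E.
  rewrite (_ : (\int[mu]_x _)%E = (\int[mu]_x (EFin \o g) x)%E).
    rewrite -[LHS]fineK; last exact: (integrable_fin_num measurableT ig).
    by rewrite -[fine _]/(Rintegral mu setT g) int0.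
  apply: ae_eq_integral => //.
  - exact: measurableT_comp.
  - by apply: filterS g0 => x gx _ /=; rewrite ger0_norm.
by move/(ae_eq_integral_abs mu measurableT mg); apply: filterS => x /(_ I) [].
Qed.

End ae.

Section fubini.
Context (R : realType) d1 d2 (X : measurableType d1) (Y : measurableType d2).
Context (mu : probability X R) (nu : probability Y R).

Lemma ae_prodP (Q : X * Y -> Prop) : {ae prodP mu nu, forall z, Q z} ->
  {ae nu, forall y, {ae mu, forall x, Q (x, y)}}.
Proof.
move=> [N [mN N0 QN]].
have mI : measurable_fun setT (fun z => (\1_N z)%:E : \bar R).
  by apply/measurable_EFinP; exact: measurable_indic.
have I0 z : (0 <= (\1_N z)%:E :> \bar R)%E by rewrite lee_fin.
have := fubini_tonelli2 (m1 := mu) (m2 := nu) _ mI I0.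
rewrite integral_indic// setIT [LHS]N0 => /esym int0.
have mG := measurable_fun_fubini_tonelli_G (m1 := mu) _ mI I0.
have G0 y : (0 <= fubini_G mu (fun z => (\1_N z)%:E) y)%E by exact: integral_ge0.
have : (\int[nu]_y `|fubini_G mu (fun z => (\1_N z)%:E) y| = 0)%E.
  by under eq_integral do rewrite gee0_abs//.
move/(ae_eq_integral_abs nu measurableT mG); apply: filterS => y /(_ I).
rewrite /fubini_G => Gy.
exists (ysection N y); split.
- exact: measurable_ysection.
- rewrite -[LHS](_ : (\int[mu]_x (\1_(ysection N y) x)%:E)%E = _); last first.
    by rewrite integral_indic ?setIT//; exact: measurable_ysection.
  rewrite -[RHS]Gy; apply: eq_integral => x _.
  by rewrite !indicE mem_ysection.
- by move=> x /= nQ; rewrite /ysection/= inE; exact: QN.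
Qed.

Lemma ae_prodP_ex (Q : X * Y -> Prop) : {ae prodP mu nu, forall z, Q z} ->
  exists y, {ae mu, forall x, Q (x, y)}.
Proof. by move=> /ae_prodP /ae_ex. Qed.

End fubini.

Section measurable_circle.
Context (R : realType) d (X : measurableType d).

Lemma measurable_circle_mul (f g : X -> circle R) :
  measurable_fun setT f -> measurable_fun setT g ->
  measurable_fun setT (fun x => f x * g x)%g.
Proof.
move=> mf mg.
exact: (@measurable_circleM _ _ _ (mfun_Sub (mem_set mf)) (mfun_Sub (mem_set mg))).
Qed.

Lemma measurable_circle_inv (f : X -> circle R) :
  measurable_fun setT f -> measurable_fun setT (fun x => (f x)^-1)%g.
Proof. by move=> mf; exact: (@measurable_circleV _ _ _ (mfun_Sub (mem_set mf))). Qed.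

End measurable_circle.

Section ergodic.
Context (R : realType) d (X : measurableType d) (mu : probability X R).
Variable tau : nat -> X -> X.
Hypothesis mtau : forall n, mpres mu mu (tau n).
Hypothesis mix : mixing mu tau.

(** Mixing applied to the pair [E], [E] gives [pr mu E = pr mu E ^+ 2]. *)
Lemma mixing_ergodic (E : set X) : measurable E ->
  (forall n, {ae mu, forall x, E (tau n x) <-> E x}) -> pr mu E = 0 \/ pr mu E = 1.
Proof.
move=> mE invE.
have cE n : pr mu (E `&` tau n @^-1` E) = pr mu E.
  apply: ae_eq_pr => //.
    by apply: measurableI => //; exact: (mpres_measurable (mtau n)).
  by apply: filterS (invE n) => x /= ->; tauto.
have := mix mE mE; under eq_fun do rewrite cE.
move=> h; have : pr mu E = pr mu E * pr mu E.
  have := cvg_lim (@Rhausdorff R) h; rewrite lim_cst; [exact|exact: norm_hausdorff].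
move=> /eqP; rewrite -subr_eq0 -{1}[pr mu E]mulr1 -mulrBr mulf_eq0 subr_eq0.
by move=> /orP[/eqP->|/eqP <-]; [left|right].
Qed.

(** The constant is the mean [m] of [f]. The invariant set where [f] exceeds [m] is null or conull;
    in either case [f - m] has a constant sign and integral zero, so it vanishes almost
    everywhere. *)
Lemma mixing_const (f : X -> R) : measurable_fun setT f -> (forall x, `|f x| <= 1) ->
  (forall n, {ae mu, forall x, f (tau n x) = f x}) ->
  exists c, {ae mu, forall x, f x = c}.
Proof.
move=> mf f1 invf.
have fi : mu.-integrable setT (EFin \o f).
  apply: (le_integrable measurableT (g := EFin \o cst 1)).
  - exact/measurable_EFinP.
  - by move=> x _ /=; rewrite lee_fin normr1.
  - exact: finite_measure_integrable_cst.
pose m := \int[mu]_x f x; exists m.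
have mE : measurable [set x | m < f x].
  rewrite (_ : [set x | _] = f @^-1` `]m, +oo[); last first.
    by apply/seteqP; split=> x /=; rewrite in_itv/= andbT.
  by rewrite -[X in measurable X]setTI; exact: mf.
have ci : mu.-integrable setT (EFin \o cst m) by exact: finite_measure_integrable_cst.
have cint : \int[mu]_x cst m x = m.
  by rewrite Rintegral_cst// [X in fine X](probability_setT mu) mulr1.
have [n|E0|E1] := mixing_ergodic mE.
- by apply: filterS (invf n) => x /= ->.
- have : {ae mu, forall x, m - f x = 0}.
    apply: ae_ge0_int0.
    + exact: (integrableB measurableT ci fi).
    + exists [set x | m < f x]; split=> //; first by rewrite prE// E0.
      by move=> x /= /negP; rewrite subr_ge0 -ltNge.
    + by rewrite (RintegralB measurableT ci fi) cint subrr.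
  by apply: filterS => x /eqP; rewrite subr_eq0 => /eqP.
- have : {ae mu, forall x, f x - m = 0}.
    apply: ae_ge0_int0.
    + exact: (integrableB measurableT fi ci).
    + exists (setT `\` [set x | m < f x]); split=> //; first exact: measurableD.
        by rewrite prE; [rewrite prD// prT E1 subrr|exact: measurableD].
      move=> x /= /negP; rewrite subr_ge0 -ltNge => fm; split=> //.
      by apply/negP; rewrite -leNgt ltW.
    + by rewrite (RintegralB measurableT fi ci) cint subrr.
  by apply: filterS => x /eqP; rewrite subr_eq0 => /eqP.
Qed.

Lemma mixing_const_circle (f : X -> circle R) : measurable_fun setT f ->
  (forall n, {ae mu, forall x, f (tau n x) = f x}) ->
  exists c, {ae mu, forall x, f x = c}.
Proof.
move=> mf invf; have [mr mi] := (measurable_circleP f).1 mf.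
have le1 (a b : R) : a ^+ 2 + b ^+ 2 = 1 -> `|a| <= 1.
  move=> ab; have : a ^+ 2 <= 1 by rewrite -ab lerDl sqr_ge0.
  by rewrite -[a ^+ 2]real_normK ?num_real// expr_le1.
have [|n|a fa] := mixing_const mr.
- by move=> x; exact/le1/circle_sqr.
- by apply: filterS (invf n) => x ->.
have [|n|b fb] := mixing_const mi.
- by move=> x; apply: (le1 _ (complex.Re (val (f x)))); rewrite addrC circle_sqr.
- by apply: filterS (invf n) => x ->.
have fab : {ae mu, forall x, complex.Re (val (f x)) = a /\ complex.Im (val (f x)) = b}.
  by apply: filterS2 fa fb.
have [x0 [x0a x0b]] := ae_ex fab; exists (f x0).
apply: filterS fab => x [xa xb]; apply: val_inj.
move: x0a x0b xa xb; case: (val (f x)) (val (f x0)) => ? ? [? ?] /=.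
by move=> -> -> -> ->.
Qed.

End ergodic.

Section quasi_invariant.
Context (R : realType) d (X : measurableType d) (mu : probability X R).
Variable tau : nat -> X -> X.
Hypothesis mtau : forall n, mpres mu mu (tau n).
Hypothesis mix : mixing mu tau.

(** In [f x * (f y)^-1] the eigenvalues cancel, so this function is invariant on the square, which
    is again mixing. It is therefore constant, and fixing a generic [y] makes [f] constant. *)
Lemma mixing_quasi_invariant (f : X -> circle R) : measurable_fun setT f ->
  (forall n, exists c, {ae mu, forall x, f (tau n x) = (c * f x)%g}) ->
  exists c, {ae mu, forall x, f x = c}.
Proof.
move=> mf qf.
pose F (z : X * X) := (f z.1 * (f z.2)^-1)%g.
have mF : measurable_fun setT F.
  apply: measurable_circle_mul; first exact: measurableT_comp.
  by apply: measurable_circle_inv; exact: measurableT_comp.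
have [n|n|c Fc] := mixing_const_circle _ (mixing_prod mtau mtau mix mix) mF.
- exact: mpres_prod_map.
- have [c fc] := qf n.
  have fc1 := mpres_ae (mpres_fst mu mu) fc.
  have fc2 := mpres_ae (mpres_snd mu mu) fc.
  apply: filterS2 fc1 fc2 => -[x y] /= fx fy.
  by rewrite /F /= fx fy invgM circle_mulgC -mulgA mulKg circle_mulgC.
have [y Fy] := ae_prodP_ex Fc.
exists (c * f y)%g; apply: filterS Fy => x <-.
by rewrite /F /= mulgVK.
Qed.

End quasi_invariant.

(** * Rigidity *)

Section polar.
Variable R : realType.
Implicit Types (c : R[i]) (a : circle R).

Definition sqmod c : R := complex.Re c ^+ 2 + complex.Im c ^+ 2.

Lemma sqmod_ge0 c : 0 <= sqmod c. Proof. by rewrite addr_ge0 ?sqr_ge0. Qed.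

Lemma sqmod_eq0 c : (sqmod c == 0) = (c == 0).
Proof.
by rewrite /sqmod paddr_eq0 ?sqr_ge0// !sqrf_eq0 eq_complex.
Qed.

Lemma sqmodM c c' : sqmod (c * c') = sqmod c * sqmod c'.
Proof. by case: c c' => [x y] [x' y']; rewrite /sqmod /=; ring. Qed.

Lemma circleE c : (`|c| == 1) = (sqmod c == 1).
Proof.
rewrite -(@eqrXn2 _ 2 `|c| 1)// -add_Re2_Im2 expr1n.
by rewrite eq_complex /= eqxx andbT.
Qed.

(** The inverse of the modulus for [c != 0], written as a real power of [sqmod] so that
    measurability is inherited. *)
Let scale c : R := sqmod c `^ (- 2^-1).

(* [c / |c|], and [1] at [c = 0], where [insub] fails *)
Definition polar c : circle R :=
  if insub (c * (scale c)%:C%C) is Some a then a else circle_one R.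

Let scale_sqr c : c != 0 -> sqmod c * scale c ^+ 2 = 1.
Proof.
move=> c0; have q0 : 0 < sqmod c by rewrite lt_def sqmod_eq0 c0 sqmod_ge0.
rewrite /scale powRN powR12_sqrt ?ltW// exprVn sqr_sqrtr ?ltW//.
by rewrite divff// gt_eqF.
Qed.

Lemma val_polar c : c != 0 -> val (polar c) = c * (scale c)%:C%C.
Proof.
move=> c0; rewrite /polar; case: insubP => [a _ ->//|].
rewrite circleE sqmodM {2}/sqmod /= expr0n addr0.
by rewrite scale_sqr// eqxx.
Qed.

Lemma polar0 : polar 0 = circle_one R.
Proof. by rewrite /polar mul0r; case: insubP => //= a; rewrite normr0 eq_sym oner_eq0. Qed.

Lemma polarM a c : c != 0 -> polar (val a * c) = (a * polar c)%g.
Proof.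
move=> c0; apply: val_inj; rewrite circle_valM !val_polar//; last first.
  by rewrite mulf_neq0// -normr_eq0 (eqP (valP a)) oner_eq0.
rewrite -mulrA; congr (_ * (_ * _%:C%C)); rewrite /scale sqmodM.
by have := circle_sqr a; rewrite -/(sqmod (val a)) => ->; rewrite mul1r.
Qed.

Lemma measurable_polar d (X : measurableType d) (f : X -> R[i]) :
  measurable_fun setT (fun x => complex.Re (f x)) ->
  measurable_fun setT (fun x => complex.Im (f x)) ->
  measurable_fun setT (fun x => polar (f x)).
Proof.
move=> mr mi.
have mq : measurable_fun setT (fun x => sqmod (f x)).
  by apply: measurable_funD; exact: measurable_funX.
have ms : measurable_fun setT (fun x => scale (f x)).
  exact: (measurableT_comp (measurable_powR _) mq).
have m0 : measurable_fun setT (fun x => sqmod (f x) == 0).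
  exact: measurable_fun_eqr.
apply/measurable_circleP; split.
  rewrite (_ : (fun x => _) = fun x =>
    if sqmod (f x) == 0 then 1 else complex.Re (f x) * scale (f x)).
    by apply: measurable_fun_ifT => //; exact: measurable_funM.
  apply/funext => x; rewrite sqmod_eq0; case: eqP => [->|/eqP fx].
    by rewrite polar0.
  by rewrite val_polar//; case: (f x) => ? ? /=; rewrite mulr0 subr0.
rewrite (_ : (fun x => _) = fun x =>
  if sqmod (f x) == 0 then 0 else complex.Im (f x) * scale (f x)).
  by apply: measurable_fun_ifT => //; exact: measurable_funM.
apply/funext => x; rewrite sqmod_eq0; case: eqP => [->|/eqP fx].
  by rewrite polar0.
by rewrite val_polar//; case: (f x) => ? ? /=; rewrite mulr0 add0r.
Qed.

End polar.

Section rigidity.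
Context (R : realType) d (Z : measurableType d) (nu : probability Z R).
Context (G : groupType) (zeta : mp_action G nu).
Context (H : normal_subgroup G) (h : nat -> G).
Hypothesis Hh : forall n, H (h n).
Hypothesis mix : mixing nu (fun n => zeta (h n)).
Local Notation V := (L2_hilbert nu).

Definition coboundary_on (kappa : cocycle zeta) :=
  exists v : unitary nu, forall k, H k ->
    kappa k = (v * unitary_act zeta k v^-1)%g.

Lemma sqint_one : (fun _ : Z => 1) \in sqint nu.
Proof. by apply/andP; split; exact: Lfun_cst. Qed.

Definition one_sqf : sqint_fun nu := exist (fun f => f \in sqint nu) _ sqint_one.

Lemma normsq_cst c : normsq nu (fun=> c) = sqmod c.
Proof. by rewrite /normsq Rintegral_cst// [X in fine X](probability_setT nu) mulr1. Qed.

(** For a representative [f] of [eta], being fixed reads [kappa_k(z) f(k^-1 z) = f(z)]. As [kappa]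
    is unimodular, the set where [f] is nonzero is invariant under [H]; by ergodicity it is null or
    conull, and the unit norm excludes the first case. Taking [polar] on both sides, which [polarM]
    allows off the zeros, gives the coboundary equation. *)
Lemma fixed_vector_coboundary (kappa : cocycle zeta) (eta : V) :
  hnorm eta = 1 -> (forall k, H k -> twist_rep kappa k eta = eta) ->
  coboundary_on kappa.
Proof.
elim/L2_ind: eta => f f1 fixf.
have fE k : H k -> {ae nu, forall z,
    val (repr (kappa k) z) * sval f (zeta k^-1%g z) = sval f z}.
  move=> Hk; have := fixf k Hk; rewrite [LHS]twist_L2E => /toL2_eqP.
  exact.
have circle0 (a : circle R) : val a != 0.
  by rewrite -normr_eq0 (eqP (valP a)) oner_eq0.
pose E := [set z | sval f z != 0].
have mq : measurable_fun setT (fun z => sqmod (sval f z)).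
  by apply: measurable_funD; apply: measurable_funX;
    [exact: measurable_Re|exact: measurable_Im].
have mE : measurable E.
  rewrite (_ : E = (fun z => sqmod (sval f z) == 0) @^-1` [set false]).
    rewrite -[X in measurable X]setTI; apply: measurable_fun_eqr => //.
  by apply/seteqP; split=> z; rewrite /E /= sqmod_eq0; [move/negbTE|move=> ->].
have f0 : {ae nu, forall z, sval f z != 0}.
  have [n||E1] := mixing_ergodic (fun n => mpres_act zeta (h n)) mix mE.
  - apply: filterS (fE (h n)^-1%g (nsubV (Hh n))) => z; rewrite invgK /E /= => <-.
    by rewrite mulf_eq0 negb_or circle0.
  - move=> E0.
    suff fz : toL2 f = toL2 0.
      move: f1; rewrite fz hnorm_toL2 -[sval (0 : sqint_fun nu)]/(fun=> 0) normsq_cst /sqmod /=.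
      by rewrite expr0n addr0 sqrtr0 => /eqP; rewrite eq_sym oner_eq0.
    apply/toL2_eqP; exists E; split=> //; first by rewrite prE// E0.
    by move=> z /= fz; apply/eqP => fz0; exact: fz.
  - exists (setT `\` E); split; first exact: measurableD.
      by rewrite prE; [rewrite prD// prT E1 subrr|exact: measurableD].
    by move=> z /= fz; split=> //.
have mv : measurable_fun setT (fun z => polar (sval f z)).
  by apply: measurable_polar; [exact: measurable_Re|exact: measurable_Im].
pose v : {mfun Z >-> circle R} := mfun_Sub (mem_set mv).
exists (to_unitary nu v) => k Hk.
rewrite [(to_unitary nu v)^-1%g]unitary_invE unitary_actE [RHS]unitary_mulE -[LHS]reprK.
apply/unitary_eqP; apply: filterS2 (fE k Hk) _ => [z|].
  2: exact: filterI f0 (mpres_ae (mpres_act zeta k^-1%g) f0).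
move=> kz [fz0 fkz0] _.
rewrite -[RHS]/(polar (sval f z) * (polar (sval f (zeta k^-1%g z)))^-1)%g -kz.
by rewrite polarM// mulgK.
Qed.

(** The twisted operator of [g] sends the constant function 1 to [kappa g], so closeness of
    [kappa g] to 1 says that this unit vector is almost invariant. The bound is [e ^+ 2] because
    [normsq] is the squared norm. *)
Lemma rigid_coboundary (s : seq G) (e : R) (kappa : cocycle zeta) :
  0 < e ->
  (forall (V : hilbertSpace R) (pi : unitary_rep G V),
      (exists2 xi : V, hnorm xi = 1 &
        forall g, g \in s -> hnorm (pi g xi - xi) < e) ->
      exists2 eta : V, hnorm eta = 1 & forall h, H h -> pi h eta = eta) ->
  (forall g, g \in s ->
    normsq nu (fun z => val (repr (kappa g) z) - 1) < e ^+ 2) ->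
  coboundary_on kappa.
Proof.
move=> e0 relT close.
have [|eta eta1 fixeta] := relT V (twist_rep kappa); last first.
  exact: fixed_vector_coboundary fixeta.
exists (toL2 one_sqf).
  by rewrite hnorm_toL2 normsq_cst /sqmod /= expr0n expr1n addr0 sqrtr1.
move=> g gs.
have -> : twist_rep kappa g (toL2 one_sqf) - toL2 one_sqf =
    toL2 (twist_sqf zeta (repr (kappa g)) g one_sqf - one_sqf).
  by rewrite [twist_rep _ _ _]twist_L2E; apply/eqP; rewrite subr_eq -toL2D subrK.
rewrite hnorm_toL2 -[ltRHS](ger0_norm (ltW e0)) -sqrtr_sqr ltr_sqrt ?exprn_gt0//.
have := close g gs; congr (_ < _); congr normsq; apply/funext => z.
by rewrite -[RHS]/(val (repr (kappa g) z) * 1 - 1) mulr1.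
Qed.

End rigidity.

(** * Splitting a transfer function *)

Section pullback.
Context (R : realType) (G : groupType).
Context d (Z : measurableType d) (nu : probability Z R) (zeta : mp_action G nu).
Context d' (X : measurableType d') (mu : probability X R) (sigma : mp_action G mu).
Context (phi : Z -> X) (mp : mpres nu mu phi).
Hypothesis equiv : forall g z, phi (zeta g z) = sigma g (phi z).

Definition mpmap : {mfun Z >-> X} := mfun_Sub (mem_set mp.1).

Definition pull (u : unitary mu) : unitary nu := to_unitary nu (repr u \o mpmap).

Lemma pullE (f : {mfun X >-> circle R}) :
  pull (to_unitary mu f) = to_unitary nu (f \o mpmap).
Proof.
apply/unitary_eqP; apply: filterS (mpres_ae mp (repr_to_unitary mu f)).
by move=> z /(_ I) fz _; exact: fz.
Qed.

Lemma pullM u v : pull (u * v)%g = (pull u * pull v)%g.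
Proof.
elim/unitary_ind: u => f; elim/unitary_ind: v => f'.
by rewrite [(_ * _)%g in LHS]unitary_mulE !pullE [RHS]unitary_mulE;
  apply/unitary_eqP; exact: aeW.
Qed.

Lemma pull1 : pull 1%g = 1%g.
Proof. by rewrite [LHS]pullE; apply/unitary_eqP; exact: aeW. Qed.

Lemma pull_act g u : pull (unitary_act sigma g u) = unitary_act zeta g (pull u).
Proof.
elim/unitary_ind: u => f.
rewrite unitary_actE !pullE unitary_actE; apply/unitary_eqP; apply: aeW => z _ /=.
by rewrite equiv.
Qed.

Definition pull_cocycle (w : cocycle sigma) : cocycle zeta.
Proof.
exists (fun g => pull (w g)) => [g h|].
  by rewrite cocycleM pullM pull_act.
by rewrite cocycle1 pull1.
Defined.

End pullback.

Section product_action.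
Context (R : realType) (G : groupType).
Context d1 (X : measurableType d1) (mu : probability X R) (a : mp_action G mu).
Context d2 (Y : measurableType d2) (nu : probability Y R) (b : mp_action G nu).

Definition prod_action : mp_action G (prodP mu nu).
Proof.
exists (fun g => prod_map (a g) (b g)).
- by case=> x y; rewrite /prod_map !mp_act1.
- by move=> g h [x y]; rewrite /prod_map !mp_actM.
- by move=> g; apply: (mpres_prod_map (mpres_act a g) (mpres_act b g)).1.
- by move=> g; apply: (mpres_prod_map (mpres_act a g) (mpres_act b g)).2.
Defined.

End product_action.

Section abelian_identities.

Section field.
Context (F : fieldType) (a b c e p q x y : F).
Hypotheses (a0 : a != 0) (b0 : b != 0) (c0 : c != 0) (e0 : e != 0).
Hypotheses (p0 : p != 0) (q0 : q != 0) (x0 : x != 0) (y0 : y != 0).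

(** Here [a], [b], [c], [e] are the values of the transfer function at [(x,t)], [(x',t)], [(x',t')],
    [(x,t')]; [p], [q] are the cocycle values at [t], [t'], and [x], [y] those at [x], [x']. Each
    cocycle value occurs once with each sign. The three identities hold in any abelian group;
    embedding the circle in [R[i]] lets [field] decide them. *)
Lemma cross_ratio_field : (a * p * x^-1) * (b * p * y^-1)^-1 * (c * q * y^-1) *
  (e * q * x^-1)^-1 = a * b^-1 * c * e^-1.
Proof. by field; rewrite ?a0 ?b0 ?c0 ?e0 ?p0 ?q0 ?x0 ?y0. Qed.

Lemma split_field : a = e * (a * b^-1 * c * e^-1 * c^-1 * b).
Proof. by field; rewrite ?a0 ?b0 ?c0 ?e0 ?p0 ?q0 ?x0 ?y0. Qed.

Lemma solve_field : a * b = c * e * p * q^-1 -> q = e * b^-1 * p * c * a^-1.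
Proof.
move=> E; have -> : c = a * b * q / (e * p).
  by rewrite E; field; rewrite ?a0 ?b0 ?c0 ?e0 ?p0 ?q0 ?x0 ?y0.
by field; rewrite ?a0 ?b0 ?c0 ?e0 ?p0 ?q0 ?x0 ?y0.
Qed.

End field.

Context (R : realType).
Implicit Types a b c e p q x y : circle R.

Let circle_neq0 a : val a != 0.
Proof. by rewrite -normr_eq0 (eqP (valP a)) oner_eq0. Qed.

Lemma circle_cross_ratio a b c e p q x y :
  ((a * p * x^-1) * (b * p * y^-1)^-1 * (c * q * y^-1) * (e * q * x^-1)^-1 =
  a * b^-1 * c * e^-1)%g.
Proof.
apply: val_inj; rewrite !(circle_valM, circle_valV); by apply: cross_ratio_field.
Qed.

Lemma circle_split a b c e : (a = e * (a * b^-1 * c * e^-1 * c^-1 * b))%g.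
Proof.
apply: val_inj; rewrite !(circle_valM, circle_valV).
by apply: split_field.
Qed.

Lemma circle_solve a b c e p q : (a * b = c * e * p * q^-1 -> q = e * b^-1 * p * c * a^-1)%g.
Proof.
move=> /(congr1 val) E; apply: val_inj; move: E; rewrite !(circle_valM, circle_valV).
by apply: solve_field.
Qed.

End abelian_identities.

Section splitting.
Context (R : realType) (G : groupType).
Context d1 (X : measurableType d1) (mu : probability X R) (a : mp_action G mu).
Context d2 (T : measurableType d2) (tau : probability T R) (b : mp_action G tau).
Context (H : normal_subgroup G) (h : nat -> G).
Hypothesis Hh : forall n, H (h n).
Hypothesis mixa : mixing mu (fun n => a (h n)).
Hypothesis mixb : mixing tau (fun n => b (h n)).
Local Notation Z := (X * T)%type.
Local Notation nu := (prodP mu tau).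
Local Notation zeta := (prod_action a b).

Definition cross (p : Z * Z) : Z := (p.1.1, p.2.2).

Lemma mpres_cross : mpres (prodP nu nu) nu cross.
Proof.
apply: mpres_prod.
  apply: measurable_fun_pair.
    exact: (measurableT_comp measurable_fst measurable_fst).
  exact: (measurableT_comp measurable_snd measurable_snd).
move=> A B mA mB.
rewrite (_ : _ @^-1` _ = (A `*` setT) `*` (setT `*` B)); last first.
  by apply/seteqP; split=> -[[x t] [x' t']] /=; rewrite /cross /=; tauto.
have mAT : measurable (A `*` [set: T]) by exact: measurableX.
have mTB : measurable ([set: X] `*` B) by exact: measurableX.
rewrite prodPE// !prodPE//.
rewrite [X in (_ * X * _)%E](probability_setT tau).
by rewrite [X in (_ * (X * _))%E](probability_setT mu) mule1 mul1e.
Qed.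

Definition swap (p : Z * Z) : Z * Z := (p.2, p.1).

Lemma mpres_swap : mpres (prodP nu nu) (prodP nu nu) swap.
Proof.
apply: mpres_prod.
  by apply: measurable_fun_pair; [exact: measurable_snd|exact: measurable_fst].
move=> A B mA mB.
rewrite (_ : _ @^-1` _ = B `*` A); first by rewrite prodPE// muleC.
by apply/seteqP; split=> -[z z'] /= [].
Qed.

(** The hypothesis says that [u] makes the cocycle [w] in the first variable cohomologous on [H] to
    [w'] in the second. Once [u] is a product, the equation separates: whatever depends on the
    second variable must be a constant for each [k]. *)
Lemma splitting (u : X * T -> circle R) (w : G -> X -> circle R) (w' : G -> T -> circle R) :
  measurable_fun setT u ->
  (forall k, H k -> {ae nu, forall z,
     u (zeta k^-1 z)%g = (u z * w' k z.2 * (w k z.1)^-1)%g}) ->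
  exists2 v : X -> circle R, measurable_fun setT v &
    forall k, H k -> exists c,
      {ae mu, forall x, w k x = (c * v x * (v (a k^-1 x))^-1)%g}.
Proof.
move=> mu_ uE.
(* the cross ratio u(x,t) u(x',t)^-1 u(x',t') u(x,t')^-1 *)
pose F p := (u p.1 * (u (cross (swap p)))^-1 * u p.2 * (u (cross p))^-1)%g.
have mcross := mpres_cross; have mswap := mpres_swap.
have mcs := mpres_comp mswap mcross.
have mF : measurable_fun setT F.
  apply: measurable_circle_mul; last first.
    by apply: measurable_circle_inv; exact: (measurableT_comp _ mcross.1).
  apply: measurable_circle_mul; last exact: measurableT_comp.
  apply: measurable_circle_mul; first exact: measurableT_comp.
  by apply: measurable_circle_inv; exact: (measurableT_comp _ mcs.1).
have mz n := mpres_act zeta (h n).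
have mixz : mixing nu (fun n => zeta (h n)).
  by apply: mixing_prod => // n; exact: mpres_act.
have [n|n|c Fc] := mixing_const_circle _ (mixing_prod mz mz mixz mixz) mF.
- exact: mpres_prod_map.
- have uh := uE _ (nsubV (Hh n)).
  have ae1 := mpres_ae (mpres_fst nu nu) uh.
  have ae2 := mpres_ae (mpres_snd nu nu) uh.
  have ae3 := mpres_ae mcross uh.
  have ae4 := mpres_ae mcs uh.
  apply: filterS2 (filterI ae1 ae2) (filterI ae3 ae4).
  rewrite invgK => -[[x t] [x' t']] [/= E1 E2] [E3 E4].
  rewrite /F /=.
  rewrite -[cross (prod_map _ _ _)]/(zeta (h n) (x, t')) E3.
  rewrite -[cross (swap (prod_map _ _ _))]/(zeta (h n) (x', t)) E4 E1 E2.
  exact: circle_cross_ratio.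
(* By Fubini some [(x', t')] has cross ratio [c] with almost every [(x, t)]; freezing it exhibits
   both factors of [u]. *)
have [[x' t'] {}Fc] := ae_prodP_ex Fc.
pose v x := u (x, t').
pose v' t := (c * (u (x', t'))^-1 * u (x', t))%g.
have mv : measurable_fun setT v by exact: (measurableT_comp mu_).
have uv : {ae nu, forall z, u z = (v z.1 * v' z.2)%g}.
  apply: filterS Fc => -[x t] Fxt; rewrite /v /v' -Fxt; exact: circle_split.
exists v => // k Hk.
have uvk := mpres_ae (mpres_act zeta k^-1%g) uv.
(* A generic [t] is frozen for each [k] separately. Its choice affects only the constant, since [v]
   was fixed beforehand. *)
have /ae_prodP_ex[t tE] : {ae nu, forall z,
    u (zeta k^-1%g z) = (u z * w' k z.2 * (w k z.1)^-1)%g /\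
    (u z = (v z.1 * v' z.2)%g /\
     u (zeta k^-1%g z) = (v (zeta k^-1%g z).1 * v' (zeta k^-1%g z).2)%g)}.
  exact: filterI (uE k Hk) (filterI uv uvk).
exists (v' t * (v' (b k^-1 t))^-1 * w' k t)%g.
apply: filterS tE => x [/= E1 [E2 E3]].
move: E1; rewrite E3 E2 /= => E1.
by rewrite (circle_solve E1).
Qed.

End splitting.

(** * Bernoulli shifts *)

Section bernoulli_mixing.
Local Open Scope group_scope.
Context (R : realType) (G : groupType) d (X0 : measurableType d).
Context (mu0 : probability X0 R) (mu : probability (pow_space G X0) R).
Hypothesis mu_prod : is_product_measure mu0 mu.
Local Notation X := (pow_space G X0).
Local Notation sigma := (bernoulli_shift mu_prod).

Lemma cylinder_undup (s : seq G) (A : G -> set X0) : cylinder (undup s) A = cylinder s A.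
Proof. by apply/seteqP; split=> x xB i; have := xB i; rewrite mem_undup. Qed.

Lemma cylinderI_disjoint (s t : seq G) (A B : G -> set X0) :
  uniq s -> uniq t -> {in s, forall i, i \notin t} ->
  (forall i, measurable (A i)) -> (forall i, measurable (B i)) ->
  mu (cylinder s A `&` cylinder t B) = (mu (cylinder s A) * mu (cylinder t B))%E.
Proof.
move=> us ut st mA mB.
pose C i := if i \in s then A i else B i.
have -> : cylinder s A `&` cylinder t B = cylinder (s ++ t) C.
  apply/seteqP; split=> [x [xA xB] i|x xC].
    rewrite mem_cat /C; case: ifP => [si _|_ /=]; [exact: xA|exact: xB].
  split=> i it.
    by have := xC i; rewrite mem_cat it /C it; exact.
  have := xC i; rewrite mem_cat it orbT /C; case: ifP => [si|_]; last exact.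
  by have := st i si; rewrite it.
rewrite !mu_prod ?cat_uniq ?us ?ut ?andbT//=; last 2 first.
- by apply/hasPn => i it; apply/negP => /st; rewrite it.
- by move=> i; rewrite /C; case: ifP.
rewrite big_cat/=; congr (_ * _)%E; apply: eq_big_seq => i si; rewrite /C ?si//.
by case: ifP => // /st; rewrite si.
Qed.

Lemma shift_cylinder g (s : seq G) (B : G -> set X0) :
  sigma g @^-1` cylinder s B = cylinder [seq g^-1 * i | i <- s] (fun j => B (g * j)).
Proof.
apply/seteqP; split=> [x xB _ /mapP[i si ->]|x xB i si].
  by rewrite mulVKg; exact: xB.
by have := xB (g^-1 * i); rewrite mulVKg; apply; exact: map_f.
Qed.

Lemma eventually_notin (h : nat -> G) (L : seq G) : injective h ->
  \forall n \near \oo, h n \notin L.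
Proof.
move=> hI; elim: L => [|g L IH]; first exact: nearW.
have gn : \forall n \near \oo, h n != g.
  have [[n0 <-]|nh] := pselect (exists n, h n = g).
    exists n0.+1 => // n /= n0n; apply/eqP => /hI nn0.
    by rewrite nn0 ltnn in n0n.
  by apply: nearW => n; apply/eqP => hn; apply: nh; exists n.
by apply: filterS2 gn IH => n gn Ln; rewrite inE negb_or gn.
Qed.

Lemma cylindersT : @cylinders G _ X0 setT.
Proof. by exists [::], (fun=> setT); split=> //; exact/seteqP. Qed.

Lemma bernoulli_mixing (h : nat -> G) : injective h -> mixing mu (fun n => sigma (h n)).
Proof.
move=> hI; apply: (mixing_pi _ (@measurable_pow_cylinders G _ X0)).
- by move=> n; exact: mpres_act.
- exact: cylinders_setI.
- exact: cylindersT.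
move=> _ _ [s [A [mA ->]]] [t [B [mB ->]]].
rewrite -(cylinder_undup s) -(cylinder_undup t).
set s' := undup s; set t' := undup t.
(* The sites [s'] meet those of the shifted cylinder, [(h n)^-1 * t'], only if [h n = i * j^-1] with
   [i] in [t'] and [j] in [s']. This excludes finitely many [n]; for all others the two cylinders
   are independent, so the sequence is eventually constant. *)
have := eventually_notin [seq p.1 * p.2^-1 | p <- [seq (i, j) | i <- t', j <- s']] hI.
move=> hn; apply: cvg_near_cst; apply: filterS hn => n hn.
have -> : sigma (h n) @^-1` cylinder t' B = _ := shift_cylinder (h n) t' B.
rewrite /pr cylinderI_disjoint ?undup_uniq//; last first.
  move=> j js; apply/negP => /mapP[i it jE]; move/negP: hn; apply.
  apply/mapP; exists (i, j); first by apply/allpairsP; exists (i, j).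
  by rewrite jE /= invgM invgK mulVKg.
  by rewrite map_inj_uniq ?undup_uniq//; exact: mulgI.
rewrite -shift_cylinder [X in (_ * X)%E](mp_act_preserving sigma (h n)); last first.
  exact: measurable_cylinder.
by rewrite fineM// fin_num_measure//; exact: measurable_cylinder.
Qed.

End bernoulli_mixing.

(** * Patterns and resampling of Bernoulli configurations *)

Section resampling.
Context (R : realType) (G : groupType) d (X0 : measurableType d).
Context (mu0 : probability X0 R) (mu : probability (pow_space G X0) R).
Hypothesis mu_prod : is_product_measure mu0 mu.
Local Notation X := (pow_space G X0).
Local Notation sigma := (bernoulli_shift mu_prod).
Context (A0 : set X0) (mA0 : measurable A0) (h : nat -> G) (hI : injective h).

(** The sites read around [g] are right translates of [g], which commute with the shift by left
    translation; hence the equivariance in [label_shift]. They are distinct as [h] is injective, so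
    the bits are independent. *)
Definition label (m : nat) (s : X) (g : G) : seq bool :=
  [seq `[< A0 (s (g * h i)%g) >] | i <- iota 0 m].

Lemma size_label m s g : size (label m s g) = m.
Proof. by rewrite size_map size_iota. Qed.

Lemma label_shift m k s g : label m (sigma k s) g = label m s (k^-1 * g)%g.
Proof. by rewrite /label; apply: eq_map => i; rewrite -mulgA. Qed.

Let sites m g : seq G := [seq (g * h i)%g | i <- iota 0 m].

Lemma label_eq m g (b : seq bool) : size b = m ->
  [set s | label m s g = b] =
  cylinder (sites m g)
    (fun j => if nth false b (index j (sites m g)) then A0 else ~` A0).
Proof.
move=> sb.
have idx i : (i < m)%N -> index (g * h i)%g (sites m g) = i.
  move=> im; have gI : injective (fun i => g * h i)%g by move=> x y /mulgI/hI.
  rewrite [LHS](index_map gI (iota 0 m) i).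
  by have := index_uniq 0%N (s := iota 0 m) (i := i); rewrite size_iota iota_uniq nth_iota//; exact.
apply/seteqP; split=> s.
  move=> lb _ /mapP[i + ->]; rewrite mem_iota add0n => /= im.
  have := congr1 (fun b => nth false b i) lb.
  rewrite idx// (nth_map 0%N) ?size_iota// nth_iota// add0n => <-.
  by case: asboolP.
move=> sC; apply: (@eq_from_nth _ false); rewrite size_label//= => i im.
rewrite (nth_map 0%N) ?size_iota// nth_iota// add0n.
have := sC (g * h i)%g; rewrite idx//.
have -> : (g * h i)%g \in sites m g by apply: map_f; rewrite mem_iota add0n.
by move=> /(_ isT); case: (nth _ _ _) => ?; case: asboolP.
Qed.

Let mB m g (b : seq bool) j :
  measurable (if nth false b (index j (sites m g)) then A0 else ~` A0).
Proof. by case: ifP => _ //; exact: measurableC. Qed.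

Lemma measurable_label_eq m g (b : seq bool) :
  measurable [set s : X | label m s g = b].
Proof.
have [sb|sb] := eqVneq (size b) m.
  by rewrite label_eq//; apply: measurable_cylinder => j; exact: mB.
rewrite (_ : [set s | _] = set0)//; apply/seteqP; split=> // s /= lb.
by move/eqP: sb; apply; rewrite -lb size_label.
Qed.

Lemma measurable_label m g (P : seq (seq bool)) :
  measurable [set s : X | label m s g \in P].
Proof.
elim: P => [|b P IH].
  by rewrite (_ : [set s | _] = set0)//; apply/seteqP; split.
rewrite (_ : [set s | _] = [set s | label m s g = b] `|` [set s | label m s g \in P]).
  by apply: measurableU => //; exact: measurable_label_eq.
apply/seteqP; split=> s /=; first by rewrite inE => /orP[/eqP|]; [left|right].
by rewrite inE => -[->|->]; rewrite ?eqxx ?orbT.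
Qed.

(** The larger of the probabilities of the two values of one bit. By independence its [m]-th power
    bounds the probability of any pattern of length [m]. *)
Definition label_bound : R := Num.max (pr mu0 A0) (1 - pr mu0 A0).

Lemma pr_label_eq m g (b : seq bool) :
  pr mu [set s : X | label m s g = b] <= label_bound ^+ m.
Proof.
have p1 : pr mu0 A0 <= 1 by rewrite -(prT mu0); exact: pr_le.
have q0 : 0 <= label_bound by rewrite le_max pr_ge0.
have [sb|sb] := eqVneq (size b) m; last first.
  rewrite (_ : [set s | _] = set0) ?/pr ?measure0 ?exprn_ge0//.
  apply/seteqP; split=> // s /= lb.
  by move/eqP: sb; apply; rewrite -lb size_label.
rewrite label_eq// -lee_fin -prE; last by apply: measurable_cylinder => j; exact: mB.
rewrite mu_prod; last 2 first.
- by rewrite map_inj_uniq ?iota_uniq// => x y /mulgI/hI.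
- by move=> j; exact: mB.
pose B j := if nth false b (index j (sites m g)) then A0 else ~` A0.
have BE j : (0 <= mu0 (B j) <= label_bound%:E)%E.
  rewrite measure_ge0 /= /B; case: ifP => _.
    by rewrite prE// lee_fin le_max lexx.
  rewrite prE; last exact: measurableC.
  by rewrite -setTD prD// prT lee_fin le_max lexx orbT.
have prod_le (s : seq G) :
    (0 <= \prod_(j <- s) mu0 (B j) <= (label_bound ^+ size s)%:E)%E.
  elim: s => [|j s /andP[IH0 IH]]; first by rewrite big_nil expr0 lexx lee_fin ler01.
  have /andP[Bj0 Bj] := BE j.
  by rewrite big_cons /= exprS EFinM mule_ge0//= lee_pmul.
have /andP[_] := prod_le (sites m g).
by rewrite size_map size_iota.
Qed.

End resampling.

Section resample.
Context (R : realType) (G : groupType) d (X0 : measurableType d).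
Context (mu0 : probability X0 R) (mu : probability (pow_space G X0) R).
Hypothesis mu_prod : is_product_measure mu0 mu.
Local Notation X := (pow_space G X0).
Local Notation sigma := (bernoulli_shift mu_prod).
Context (A0 : set X0) (mA0 : measurable A0) (h : nat -> G) (hI : injective h).
Local Notation label := (label A0 h).
Local Notation T := (prodP mu mu).
Local Notation Z := (prodP mu T).
Local Notation zeta := (prod_action sigma (prod_action sigma sigma)).

(** The point [z] is [(x, (y, s))]. With [P] a list, the path from [[::]] to [all_labels m] is an
    induction that adds one pattern at a time. *)
Definition resample m (P : seq (seq bool)) (z : X * (X * X)) : X :=
  fun g => if label m z.2.2 g \in P then z.2.1 g else z.1 g.

Lemma resample_equiv m P g z : resample m P (zeta g z) = sigma g (resample m P z).
Proof. by apply/funext => k; rewrite /resample -[(zeta g z).2.2]/(sigma g z.2.2) label_shift. Qed.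

Lemma resample0 m z : resample m [::] z = z.1.
Proof. by []. Qed.

Definition all_labels m : seq (seq bool) := [seq val t | t <- enum {: m.-tuple bool}].

Lemma resample_all m z : resample m (all_labels m) z = z.2.1.
Proof.
apply/funext => g; rewrite /resample ifT//.
by apply/mapP; exists (Tuple (introT eqP (size_label A0 h m z.2.2 g))); rewrite ?mem_enum.
Qed.

Lemma measurable_resample m P : measurable_fun setT (resample m P).
Proof.
apply: (@measurability _ _ _ _ setT (resample m P) (@coordinate_sets G d X0)) => //.
move=> _ [_ [g [A [mA ->]]] <-]; rewrite setTI.
pose L : set (X * (X * X)) := [set z | label m z.2.2 g \in P].
have mL : measurable L.
  have msnd : measurable_fun setT (fun z : X * (X * X) => z.2.2).
    exact: (measurableT_comp measurable_snd measurable_snd).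
  rewrite (_ : L = (fun z => z.2.2) @^-1` [set s | label m s g \in P]) //.
  rewrite -[_ @^-1` _]setTI; apply: msnd => //.
  exact: measurable_label.
have mg : measurable [set x : X | A (x g)] by exact: measurable_coordinate.
have mY : measurable [set z : X * (X * X) | A (z.2.1 g)].
  rewrite (_ : [set z | _] = (fun z : X * (X * X) => z.2.1) @^-1` [set x | A (x g)])//.
  rewrite -[_ @^-1` _]setTI.
  by apply: (measurableT_comp measurable_fst measurable_snd).
have mX : measurable [set z : X * (X * X) | A (z.1 g)].
  rewrite (_ : [set z | _] = (fun z : X * (X * X) => z.1) @^-1` [set x | A (x g)])//.
  by rewrite -[_ @^-1` _]setTI; exact: measurable_fst.
rewrite (_ : _ @^-1` _ = (L `&` [set z | A (z.2.1 g)]) `|` (~` L `&` [set z | A (z.1 g)])).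
  by apply: measurableU; apply: measurableI => //; exact: measurableC.
apply/seteqP; split=> z; rewrite /resample /L /=; first by case: ifP; [left|right].
by move=> [[-> //]|[/negP/negbTE -> //]].
Qed.

(** For fixed [s], the sites [F] of a cylinder split into [D s], read from [y], and [E s], read from
    [x]. Since [x] and [y] are independent with the same law, the conditional probability of the
    cylinder is [p (D s) * p (E s) = p F], whatever [s] is. The integration is done over [x], then
    [y], then [s]. *)
Lemma mpres_resample m P : mpres Z mu (resample m P).
Proof.
have mr := measurable_resample m P; split=> // B mB.
pose f' : {mfun (X * (X * X))%type >-> X} := mfun_Sub (mem_set mr).
rewrite -[LHS]/(pushforward Z f' B).
apply: eq_cylinders mB => [|F A uF mA].
  rewrite [X in (X < _)%E](_ : _ = 1%E) ?ltry//.
  exact: (probability_setT Z).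
pose D s := [seq g <- F | label m s g \in P].
pose E s := [seq g <- F | label m s g \notin P].
pose p (L : seq G) : \bar R := (\prod_(g <- L) mu0 (A g))%E.
have pDE s : (p (D s) * p (E s) = p F)%E.
  by rewrite /p [RHS](bigID (fun g => label m s g \in P)) /= !big_filter.
have p0 L : (0 <= p L)%E by apply: prode_ge0 => i _.
set C := f' @^-1` cylinder F A.
have mC : measurable C.
  by rewrite -[C]setTI; apply: measurable_funPT => //; exact: measurable_cylinder.
have CE x y s : C (x, (y, s)) <-> cylinder (D s) A y /\ cylinder (E s) A x.
  split=> [xC|[yD xE] g gF].
    split=> g; rewrite mem_filter => /andP[gP /xC]; rewrite /= /resample/=.
      by rewrite gP.
    by rewrite (negbTE gP).
  rewrite /= /resample /=; case: ifPn => gP.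
    by apply: yD; rewrite mem_filter gP.
  by apply: xE; rewrite mem_filter gP.
have mI : measurable_fun setT (fun z => (\1_C z)%:E : \bar R).
  by apply/measurable_EFinP; exact: measurable_indic.
have I0 z : (0 <= (\1_C z)%:E :> \bar R)%E by rewrite lee_fin.
have mG := measurable_fun_fubini_tonelli_G (m1 := mu) _ mI I0.
have GE t : fubini_G mu (fun z => (\1_C z)%:E) t = ((\1_(cylinder (D t.2) A) t.1)%:E * p (E t.2))%E.
  case: t => y s; rewrite /fubini_G /=.
  rewrite (eq_integral (fun x => (\1_(cylinder (D s) A) y)%:E *
      (\1_(cylinder (E s) A) x)%:E)%E); last first.
    move=> x _; rewrite -EFinM !indicE -natrM mulnb; congr (_%:R)%:E; congr nat_of_bool.
    by apply/idP/andP; rewrite !inE CE.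
  rewrite ge0_integralZl//; last first.
    by apply/measurable_EFinP; apply: measurable_indic; exact: measurable_cylinder.
  rewrite integral_indic ?setIT//; last exact: measurable_cylinder.
  by rewrite [X in (_ * X)%E]mu_prod// filter_uniq.
transitivity (Z C); first by [].
apply: etrans _ (esym (mu_prod uF mA)); rewrite -/(p F).
have -> : Z C = (\int[Z]_z (\1_C z)%:E)%E by rewrite integral_indic ?setIT.
rewrite (fubini_tonelli2 (m1 := mu) (m2 := T) _ mI I0).
rewrite (fubini_tonelli2 (m1 := mu) (m2 := mu) _ mG); last first.
  by move=> t; apply: integral_ge0 => x _; rewrite lee_fin.
rewrite (eq_integral (fun=> p F)).
  by rewrite integral_cst// [X in (_ * X)%E](probability_setT mu) mule1.
move=> s _; rewrite /fubini_G.
rewrite (eq_integral (fun y => ((\1_(cylinder (D s) A) y)%:E * p (E s))%E)); last first.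
  by move=> y _; exact: GE (y, s).
rewrite ge0_integralZr//; last first.
  by apply/measurable_EFinP; apply: measurable_indic; exact: measurable_cylinder.
rewrite integral_indic ?setIT//; last exact: measurable_cylinder.
by rewrite [X in (X * _)%E]mu_prod ?pDE// filter_uniq.
Qed.

End resample.

Lemma prU_le d (X : measurableType d) (R : realType) (P : probability X R) (A B : set X) :
  measurable A -> measurable B -> pr P (A `|` B) <= pr P A + pr P B.
Proof.
move=> mA mB; rewrite -lee_fin EFinD -!prE//; last exact: measurableU.
exact: measureU2.
Qed.

Section resample_cvg.
Context (R : realType) (G : groupType) d (X0 : measurableType d).
Context (mu0 : probability X0 R) (mu : probability (pow_space G X0) R).
Hypothesis mu_prod : is_product_measure mu0 mu.
Local Notation X := (pow_space G X0).
Context (A0 : set X0) (mA0 : measurable A0) (h : nat -> G) (hI : injective h).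
Hypothesis A0_gt0 : 0 < pr mu0 A0.
Hypothesis A0_lt1 : pr mu0 A0 < 1.
Local Notation label := (label A0 h).
Local Notation phi := (resample A0 h).
Local Notation Z := (prodP mu (prodP mu mu)).

(** The event that the pattern [b] occurs at a site of [F]: off it, resampling with [P] and with
    [b :: P] agree on [F]. *)
Let bad m (b : seq bool) (F : seq G) : set (X * (X * X)) :=
  [set z | exists2 g, g \in F & label m z.2.2 g = b].

Let badE m b g F : bad m b (g :: F) =
  (fun z => z.2.2) @^-1` [set s | label m s g = b] `|` bad m b F.
Proof.
apply/seteqP; split=> z; rewrite /bad /=.
  by move=> [k]; rewrite inE => /orP[/eqP-> ?|kF ?]; [left|right; exists k].
move=> [lb|[k kF lb]]; first by exists g => //; rewrite inE eqxx.
by exists k => //; rewrite inE kF orbT.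
Qed.

Let mpres_22 : mpres Z mu (fun z => z.2.2).
Proof. exact: (mpres_comp (mpres_snd mu (prodP mu mu)) (mpres_snd mu mu)). Qed.

Let bad0 m b : bad m b [::] = set0.
Proof. by apply/seteqP; split=> // z [g]; rewrite in_nil. Qed.

Let measurable_bad m b F : measurable (bad m b F).
Proof.
elim: F => [|g F IH]; first by rewrite bad0.
rewrite badE; apply: measurableU => //.
by apply: (mpres_measurable mpres_22); exact: measurable_label_eq.
Qed.

Let pr_bad m b F : pr Z (bad m b F) <= (size F)%:R * label_bound mu0 A0 ^+ m.
Proof.
elim: F => [|g F IH]; first by rewrite bad0 /pr measure0 mul0r.
have ml : measurable [set s : X | label m s g = b] by exact: measurable_label_eq.
rewrite badE; apply: le_trans (prU_le _ _ _) _ => //.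
  exact: (mpres_measurable mpres_22).
rewrite -natr1 mulrDl mul1r addrC; apply: lerD => //.
rewrite /pr mpres_22.2//; exact: pr_label_eq.
Qed.

(** For cylinders the error is at most the probability of [bad], hence [size F * q ^ n], which
    depends neither on the list nor on the added pattern. Both may therefore vary freely with [n],
    which is what later yields uniformity. *)
Lemma resample_cvg (P : nat -> seq (seq bool)) (b : nat -> seq bool) (A B : set X) :
  measurable A -> measurable B ->
  pr Z (phi n (P n) @^-1` A `&` phi n (b n :: P n) @^-1` B) @[n --> \oo] -->
  pr mu (A `&` B).
Proof.
have mr m Q : mpres Z mu (phi m Q) by exact: (mpres_resample mu_prod).
have mp1 n : mpres Z mu (phi n (P n)) by exact: mr.
have mp2 n : mpres Z mu (phi n (b n :: P n)) by exact: mr.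
have mpid : mpres mu mu id by split.
have cE := @measurable_pow_cylinders G _ X0.
have cI := @cylinders_setI G _ X0.
have cT := @cylindersT G _ X0.
move=> mA_ mB_.
refine (cvg_coupling mp1 mpid mp2 mpid cE cI cT cE cI cT _ mA_ mB_).
move=> {mA_ mB_}{}A {}B [s [A' [mA' AE]]] [F [B' [mB' BE]]].
rewrite !preimage_id.
have mA : measurable A by rewrite AE; exact: measurable_cylinder.
have mB : measurable B by rewrite BE; exact: measurable_cylinder.
set q := label_bound mu0 A0.
have q0 : 0 <= q by rewrite le_max pr_ge0.
have q1 : `|q| < 1 by rewrite ger0_norm// gt_max A0_lt1/= ltrBlDr ltrDl.
have geo := @cvg_geometric R (size F)%:R q q1.
apply/cvgrPdist_le => e e0.
have /cvgrPdist_le/(_ _ e0) := geo; apply: filterS => n.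
rewrite sub0r normrN ger0_norm; last by rewrite /geometric /= mulr_ge0// exprn_ge0.
rewrite /geometric /= => Fe.
(* Because the first resampling preserves measure, the limit is its probability of lying in both [A]
   and [B]; only membership in [B] then has to be compared between the two resamplings. *)
have -> : pr mu (A `&` B) = pr Z (phi n (P n) @^-1` (A `&` B)).
  by rewrite /pr (mr n (P n)).2//; exact: measurableI.
have same z : ~ bad n (b n) F z ->
    B (phi n (P n) z) <-> B (phi n (b n :: P n) z).
  move=> nb; rewrite BE /cylinder /=.
  have E g : g \in F -> phi n (P n) z g = phi n (b n :: P n) z g.
    move=> gF; rewrite /resample inE; case: eqP => // lb.
    by exfalso; apply: nb; exists g.
  by split=> h' g gF; have := h' g gF; rewrite E.
set S1 := phi n (P n) @^-1` (A `&` B).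
set S2 := _ `&` _.
have mS1 : measurable S1 by apply: (mpres_measurable (mr _ _)); exact: measurableI.
have mS2 : measurable S2 by apply: measurableI; apply: (mpres_measurable (mr _ _)).
have le (U V : set (X * (X * X))) : measurable U -> measurable V ->
    (forall z, ~ bad n (b n) F z -> U z -> V z) -> pr Z U <= pr Z V + e.
  move=> mU mV UV; apply: (@le_trans _ _ (pr Z (V `|` bad n (b n) F))).
    apply: pr_le => //; first exact: measurableU.
    move=> z Uz; have [bz|bz] := pselect (bad n (b n) F z); [by right|left].
    exact: UV.
  apply: le_trans (prU_le _ _ _) _ => //; rewrite lerD2l.
  exact: le_trans (pr_bad _ _ _) Fe.
have le12 : pr Z S1 <= pr Z S2 + e.
  by apply: le => // z nb [Az Bz]; split=> //; apply/(same z nb).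
have le21 : pr Z S2 <= pr Z S1 + e.
  by apply: le => // z nb [Az Bz]; split=> //; apply/(same z nb).
by rewrite ler_distl lerBlDr; exact: (introT andP (conj le21 le12)).
Qed.

End resample_cvg.

(** * From convergence of couplings to closeness in mean square *)

Section coupling_L2.
Context (R : realType) d (W : measurableType d) (P : probability W R).
Context dX (X : measurableType dX) (mu : probability X R).
Variables (f g : nat -> W -> X).
Hypothesis mpf : forall n, mpres P mu (f n).
Hypothesis mpg : forall n, mpres P mu (g n).
Hypothesis fg : forall A B, measurable A -> measurable B ->
  pr P (f n @^-1` A `&` g n @^-1` B) @[n --> \oo] --> pr mu (A `&` B).

(* Two values in [-1, 1] at distance more than [2 / N.+1] are separated by a
   threshold [thr N j], so [v \o f n] and [v \o g n] are close off finitely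
   many events handled by [fg]. *)
Let thr (N j : nat) : R := -1 + 2 * j%:R / N.+1%:R.

(** Take the least [j] with [a < thr N j]. Its predecessor lies at or below [a] and the spacing is
    [2 / N.+1], so [thr N j] does not pass [b]. The thresholds run from -1 at [j = 0] to 1 at
    [j = N.+1]. *)
Let grid N (a b : R) : -1 <= a -> b <= 1 -> a + 2 / N.+1%:R < b ->
  exists2 j, (j < N.+2)%N & a < thr N j <= b.
Proof.
move=> a1 b1 ab.
have N0 : 0 < N.+1%:R :> R by rewrite ltr0n.
have a_1 : a < 1.
  by apply: lt_le_trans b1; apply: le_lt_trans ab; rewrite lerDl divr_ge0// ltW.
have thrN : thr N N.+1 = 1 by rewrite /thr -mulrA divff ?gt_eqF//; ring.
have ex : exists j, a < thr N j.
  by exists N.+1; rewrite thrN.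
case: (ex_minnP ex) => j aj jmin.
have j0 : (0 < j)%N.
  by rewrite lt0n; apply/negP => /eqP j0; move: aj; rewrite j0 /thr mulr0 mul0r addr0 ltNge a1.
have jle : thr N j.-1 <= a.
  by rewrite leNgt; apply/negP => /jmin; rewrite -ltnS prednK// ltnn.
have jE : thr N j = thr N j.-1 + 2 / N.+1%:R.
  have jR : j%:R = j.-1%:R + 1 :> R by rewrite natr1 prednK.
  by rewrite /thr jR mulrDr mulr1 mulrDl addrA.
exists j; last by rewrite aj jE /=; apply: ltW; apply: le_lt_trans ab; rewrite lerD2r.
by rewrite ltnS; apply: jmin; rewrite thrN.
Qed.

Let apart (n : nat) (B : set X) : set W :=
  (f n @^-1` B `&` g n @^-1` (~` B)) `|` (f n @^-1` (~` B) `&` g n @^-1` B).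

Let measurable_apart n B : measurable B -> measurable (apart n B).
Proof.
move=> mB; have mC := measurableC mB.
by apply: measurableU; apply: measurableI;
  (exact: (mpres_measurable (mpf n)) || exact: (mpres_measurable (mpg n))).
Qed.

(** In the limit the two maps coincide, so the limiting mass is that of [B] intersected with its
    complement. *)
Let apart_cvg B : measurable B -> pr P (apart n B) @[n --> \oo] --> (0 : R).
Proof.
move=> mB; have mC := measurableC mB.
have h1 := fg mB mC; have h2 := fg mC mB.
rewrite setICr in h1; rewrite setICl in h2.
have pr0 : pr mu set0 = 0 by rewrite /pr measure0.
rewrite pr0 in h1 h2.
apply: (squeeze_cvgr (f := fun=> 0) (h := fun n =>
  pr P (f n @^-1` B `&` g n @^-1` (~` B)) + pr P (f n @^-1` (~` B) `&` g n @^-1` B))).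
- apply: nearW => n; rewrite pr_ge0 /=; apply: prU_le; apply: measurableI;
    (exact: (mpres_measurable (mpf n)) || exact: (mpres_measurable (mpg n))).
- exact: cvg_cst.
- by rewrite -[0]addr0; apply: cvgD.
Qed.

Let apart_seq n (B : nat -> set X) (s : seq nat) : set W :=
  [set z | exists2 j, j \in s & apart n (B j) z].

Let apart_seq0 n B : apart_seq n B [::] = set0.
Proof. by apply/seteqP; split=> // z [j]; rewrite in_nil. Qed.

Let apart_seqS n B j s : apart_seq n B (j :: s) = apart n (B j) `|` apart_seq n B s.
Proof.
apply/seteqP; split=> z; rewrite /apart_seq /=.
  by move=> [k]; rewrite inE => /orP[/eqP-> ?|kF ?]; [left|right; exists k].
move=> [lb|[k kF lb]]; first by exists j => //; rewrite inE eqxx.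
by exists k => //; rewrite inE kF orbT.
Qed.

Let measurable_apart_seq n B s : (forall j, measurable (B j)) ->
  measurable (apart_seq n B s).
Proof.
move=> mB; elim: s => [|j s IH]; first by rewrite apart_seq0.
by rewrite apart_seqS; apply: measurableU => //; exact: measurable_apart.
Qed.

Let apart_seq_cvg B s : (forall j, measurable (B j)) ->
  pr P (apart_seq n B s) @[n --> \oo] --> (0 : R).
Proof.
move=> mB; elim: s => [|j s IH].
  under eq_fun do rewrite apart_seq0 /pr measure0; exact: cvg_cst.
apply: (squeeze_cvgr (f := fun=> 0) (h := fun n =>
  pr P (apart n (B j)) + pr P (apart_seq n B s))).
- apply: nearW => n; rewrite pr_ge0 /= apart_seqS; apply: prU_le.
    exact: measurable_apart.
  exact: measurable_apart_seq.
- exact: cvg_cst.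
- by rewrite -[0]addr0; apply: cvgD => //; exact: apart_cvg.
Qed.

Let Rintegral_indic (A : set W) : measurable A -> \int[P]_z \1_A z = pr P A.
Proof. by move=> mA; rewrite /Rintegral integral_indic// setIT. Qed.

Lemma coupling_L2 (v : X -> R) : measurable_fun setT v -> (forall x, `|v x| <= 1) ->
  \int[P]_z (v (f n z) - v (g n z)) ^+ 2 @[n --> \oo] --> (0 : R).
Proof.
move=> mv v1.
have vb x : -1 <= v x <= 1 by rewrite -ler_norml.
have mvf n : measurable_fun setT (fun z => v (f n z)) by exact: (measurableT_comp mv (mpf n).1).
have mvg n : measurable_fun setT (fun z => v (g n z)) by exact: (measurableT_comp mv (mpg n).1).
apply/cvgrPdist_le => e e0.
(* Off the bad event the two values differ by at most the grid spacing, whose square takes up half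
   of [e]. *)
have [N Ne] : exists N : nat, (2 / N.+1%:R : R) ^+ 2 <= e / 2.
  have se : 0 < Num.sqrt (e / 2) by rewrite sqrtr_gt0 divr_gt0.
  exists (Num.truncn (2 / Num.sqrt (e / 2))).
  have lt := truncnS_gt (2 / Num.sqrt (e / 2)).
  have q0 : 0 <= e / 2 by rewrite divr_ge0// ltW.
  rewrite -[leRHS](sqr_sqrtr q0) ler_pXn2r ?nnegrE ?divr_ge0 ?sqrtr_ge0//.
  by rewrite ler_pdivrMr ?ltr0n// -ler_pdivrMl// mulrC ltW.
pose B j : set X := [set x | v x < thr N j].
have mB j : measurable (B j).
  rewrite (_ : B j = v @^-1` `]-oo, thr N j[); last first.
    by apply/seteqP; split=> x /=; rewrite /B /= in_itv.
  by rewrite -[_ @^-1` _]setTI; exact: mv.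
(* On the bad event the squared difference of two values in [[-1, 1]] is at most 4, and
   [4 * (e / 8)] is the other half of [e]. *)
have e8 : 0 < e / 8 by rewrite divr_gt0.
have /cvgrPdist_le/(_ _ e8) := apart_seq_cvg (iota 0 N.+2) mB.
apply: filterS => n; rewrite !sub0r !normrN ger0_norm ?pr_ge0// => prn.
set bad := apart_seq n B (iota 0 N.+2) in prn.
have mbad : measurable bad by exact: measurable_apart_seq.
have ib : P.-integrable setT (EFin \o (\1_bad : W -> R)).
  exact: integrable_indic.
have iZb : P.-integrable setT (EFin \o (fun z => 4 * (\1_bad z : R))).
  exact: (integrableZl measurableT 4 ib).
have ic : P.-integrable setT (EFin \o (cst ((2 / N.+1%:R : R) ^+ 2))).
  exact: finite_measure_integrable_cst.
rewrite ger0_norm; last by apply: Rintegral_ge0 => z _; exact: sqr_ge0.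
have sq4 z : (v (f n z) - v (g n z)) ^+ 2 <= 4.
  have /andP[a1 a2] := vb (f n z); have /andP[b1 b2] := vb (g n z).
  by nra.
apply: (@le_trans _ _ (\int[P]_z ((2 / N.+1%:R : R) ^+ 2 + 4 * \1_bad z))).
  apply: le_Rintegral => //.
  - apply: (le_integrable measurableT (g := EFin \o cst 4)).
    + by apply/measurable_EFinP; apply: measurable_funX; exact: measurable_funB.
    + by move=> z _ /=; rewrite lee_fin !ger0_norm ?sqr_ge0.
    + exact: finite_measure_integrable_cst.
  - exact: (integrableD measurableT ic iZb).
  move=> z _; have [bz|bz] := pselect (bad z).
    by rewrite indicE mem_set// mulr1; apply: le_trans (sq4 z) _; rewrite lerDr sqr_ge0.
  rewrite indicE memNset// mulr0 addr0.
  have /andP[a1 a2] := vb (f n z); have /andP[b1 b2] := vb (g n z).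
  rewrite -[X in X <= _]real_normK ?num_real// ler_pXn2r ?nnegrE ?divr_ge0//.
  rewrite leNgt; apply/negP => far; apply: bz.
  have [gf|fg'] := leP (v (g n z)) (v (f n z)).
    rewrite ger0_norm ?subr_ge0// in far.
    have [|||j jN /andP[j1 j2]] := @grid N (v (g n z)) (v (f n z)) => //; first by rewrite -ltrBrDl.
    exists j; first by rewrite mem_iota.
    by right; split=> //; rewrite /B /=; apply/negP; rewrite -leNgt.
  rewrite ltr0_norm ?subr_lt0// opprB in far.
  have [|||j jN /andP[j1 j2]] := @grid N (v (f n z)) (v (g n z)) => //; first by rewrite -ltrBrDl.
  exists j; first by rewrite mem_iota.
  by left; split=> //; rewrite /B /=; apply/negP; rewrite -leNgt.
rewrite (RintegralD measurableT ic iZb) Rintegral_cst// [X in fine X](probability_setT P).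
rewrite RintegralZl// Rintegral_indic// mulr1.
by rewrite [e]splitr; apply: lerD => //; lra.
Qed.

End coupling_L2.

(** * Characters *)

Section constants.
Local Open Scope group_scope.
Context (R : realType) (G : groupType) d (X : measurableType d).
Context (mu : probability X R) (sigma : mp_action G mu).

Definition ucst (c : circle R) : unitary mu := to_unitary mu (cst c).

Lemma ucstM a b : ucst (a * b) = ucst a * ucst b.
Proof. by rewrite [RHS]unitary_mulE; apply/unitary_eqP; exact: aeW. Qed.

Lemma ucst_act g c : unitary_act sigma g (ucst c) = ucst c.
Proof. by rewrite unitary_actE; apply/unitary_eqP; exact: aeW. Qed.

Lemma ucst_inj : injective ucst.
Proof. by move=> a b /unitary_eqP/ae_ex[x]; exact. Qed.

Lemma eigen_const (H : normal_subgroup G) (h : nat -> G) (u : unitary mu) :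
  (forall n, H (h n)) -> mixing mu (fun n => sigma (h n)) ->
  (forall k, H k -> exists c, unitary_act sigma k u = ucst c * u) ->
  exists c, u = ucst c.
Proof.
move=> Hh mix; elim/unitary_ind: u => f fE.
have [n|||c fc] := @mixing_quasi_invariant _ _ _ mu (fun n => sigma (h n)) _ mix f.
- exact: mpres_act.
- exact: measurable_funPT.
- move=> n; have [c] := fE _ (nsubV (Hh n)).
  rewrite unitary_actE [(_ * _)%g]unitary_mulE => /unitary_eqP fc; exists c.
  by apply: filterS fc => x /(_ I); rewrite /= invgK.
by exists c; apply/unitary_eqP; apply: filterS fc => x fx _.
Qed.

End constants.

Section extension.
Local Open Scope group_scope.
Context (R : realType) (G : groupType) d (X : measurableType d).
Context (mu : probability X R) (sigma : mp_action G mu).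
Context (H : normal_subgroup G) (h : nat -> G).
Hypothesis Hh : forall n, H (h n).
Hypothesis mix : mixing mu (fun n => sigma (h n)).

(** After replacing [w] by the equivalent [w'], its values on [H] are constants. For [k] in [H],
    normality puts [k ^ g] in [H], and expanding [w'] at [g * k ^ g = k * g] in two ways shows that
    [w' g] is an eigenvector of every [k] in [H]. By mixing it is constant, and the cocycle identity
    among constants is multiplicativity. *)
Lemma cocycle_extension (w : cocycle sigma) (v : unitary mu) :
  (forall k, H k -> exists c, w k = ucst mu c * v * unitary_act sigma k v^-1) ->
  exists gamma : character R G, cocycle_equivalent w (character_cocycle sigma gamma).
Proof.
move=> wH; pose w' g := v^-1 * w g * unitary_act sigma g v.
have mulC := @unitary_mulgC _ _ _ mu.
have actC g k u : unitary_act sigma (g * k) u = unitary_act sigma g (unitary_act sigma k u).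
  elim/unitary_ind: u => f; rewrite !unitary_actE; apply/unitary_eqP; apply: aeW => x _ /=.
  by rewrite invgM mp_actM.
have w'M g k : w' (g * k) = w' g * unitary_act sigma g (w' k).
  rewrite /w' cocycleM !unitary_actM unitary_actV actC -!mulgA; congr (_ * (_ * _)).
  by rewrite mulVKg.
have w'H k : H k -> exists c, w' k = ucst mu c.
  move=> /wH[c wk]; exists c; rewrite /w' wk unitary_actV.
  by rewrite -!mulgA mulVg mulg1 mulC -mulgA mulgV mulg1.
have w'c g : exists c, w' g = ucst mu c.
  apply: (eigen_const Hh mix) => k Hk.
  have [c1 k1] := w'H _ Hk.
  have [c2 k2] := w'H _ (nsubJ g Hk).
  have : w' (g * k ^ g) = w' (k * g) by rewrite -conjgC.
  rewrite (w'M g (k ^ g)) (w'M k g) k1 k2 ucst_act => E; exists (c2 * c1^-1).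
  have -> : unitary_act sigma k (w' g) = ucst mu c1^-1 * (ucst mu c1 * unitary_act sigma k (w' g)).
    by rewrite mulgA -ucstM mulVg mul1g.
  by rewrite -E ucstM (mulC (w' g)) !mulgA (mulC (ucst _ c2)).
have [gamma gE] := choice w'c.
have gM g k : gamma (g * k) = gamma g * gamma k.
  by apply: (@ucst_inj _ _ _ mu); rewrite ucstM -!gE w'M (gE k) ucst_act.
exists (Character gM), v^-1 => g.
by rewrite invgK -[LHS]/(ucst mu (gamma g)) -gE.
Qed.

(** An equivalence [v] satisfies [sigma_k(v) = a_k b_k^-1 v], so it is an eigenvector and hence
    constant; a constant [v] cancels from the equivalence. *)
Lemma character_rigid (a b : character R G) :
  cocycle_equivalent (character_cocycle sigma a) (character_cocycle sigma b) -> a = b.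
Proof.
move=> [v vE].
have mulC := @unitary_mulgC _ _ _ mu.
have vE' g : ucst mu (b g) = v * ucst mu (a g) * unitary_act sigma g v^-1 by exact: vE.
have [c vc] : exists c, v = ucst mu c.
  apply: (eigen_const Hh mix) => k Hk; exists (a k * (b k)^-1).
  have := vE' k; rewrite unitary_actV => /(congr1 (fun u => u * unitary_act sigma k v)).
  rewrite mulgVK (mulC v) => E.
  have -> : unitary_act sigma k v = ucst mu (b k)^-1 * (ucst mu (b k) * unitary_act sigma k v).
    by rewrite mulgA -ucstM mulVg mul1g.
  by rewrite E ucstM !mulgA (mulC (ucst _ (a k))).
apply: character_ext => g; apply: (@ucst_inj _ _ _ mu).
rewrite vE' unitary_actV {2}vc ucst_act -vc (mulC v).
by rewrite mulgK.
Qed.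

End extension.

(** * Cocycles of Bernoulli shifts with a rigid normal subgroup *)

Section chain.
Context (R : realType) d (Z : measurableType d) (nu : probability Z R).
Context (G : groupType) (zeta : mp_action G nu) (H : normal_subgroup G).

Lemma coboundary_on1 : coboundary_on H (1%g : cocycle zeta).
Proof.
by exists 1%g => k _; rewrite invg1 unitary_act_one mulg1.
Qed.

(** This is why the number of resampling steps does not matter: transfer functions multiply and no
    error accumulates. *)
Lemma coboundary_onM (a b : cocycle zeta) :
  coboundary_on H a -> coboundary_on H b -> coboundary_on H (a * b)%g.
Proof.
move=> [u uE] [v vE]; exists (u * v)%g => k Hk.
rewrite -[LHS]/(a k * b k)%g uE// vE// !unitary_actV unitary_actM invgM.
rewrite -!mulgA; congr (_ * _)%g.
by rewrite [LHS]unitary_mulgC -mulgA.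
Qed.

End chain.

Section rigid_bernoulli.
Context (R : realType) (G : groupType) d (X0 : measurableType d).
Context (mu0 : probability X0 R) (mu : probability (pow_space G X0) R).
Hypothesis mu_prod : is_product_measure mu0 mu.
Local Notation X := (pow_space G X0).
Local Notation sigma := (bernoulli_shift mu_prod).
Context (A0 : set X0) (mA0 : measurable A0).
Hypothesis A0_gt0 : 0 < pr mu0 A0.
Hypothesis A0_lt1 : pr mu0 A0 < 1.
Context (H : normal_subgroup G) (h : nat -> G) (hI : injective h).
Hypothesis Hh : forall n, H (h n).
Hypothesis relT : relative_property_T R H.
Local Notation T := (prodP mu mu).
Local Notation Z := (prodP mu T).
Local Notation zeta := (prod_action sigma (prod_action sigma sigma)).

Let mix : mixing mu (fun n => sigma (h n)).
Proof. exact: bernoulli_mixing. Qed.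

Let mixT : mixing T (fun n => prod_action sigma sigma (h n)).
Proof. by apply: mixing_prod => // n; exact: mpres_act. Qed.

Let mixZ : mixing Z (fun n => zeta (h n)).
Proof.
apply: (mixing_prod _ _ mix mixT) => n; first exact: mpres_act.
exact: (mpres_act (prod_action sigma sigma)).
Qed.

Variable w : cocycle sigma.

Definition resample_cocycle m P : cocycle zeta :=
  pull_cocycle (mpres_resample mu_prod mA0 hI m P)
    (resample_equiv mu_prod A0 h m P) w.

Lemma resample_cocycle_ae m P g : {ae Z, forall z,
  repr (resample_cocycle m P g) z = repr (w g) (resample A0 h m P z)}.
Proof.
have := repr_to_unitary Z (repr (w g) \o mpmap (mpres_resample mu_prod mA0 hI m P)).
by apply: filterS => z /(_ I).
Qed.

Let kappa m P Q : cocycle zeta := (resample_cocycle m P * (resample_cocycle m Q)^-1)%g.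

Let kappa_ae m P Q g : {ae Z, forall z, repr (kappa m P Q g) z =
  (repr (w g) (resample A0 h m P z) * (repr (w g) (resample A0 h m Q z))^-1)%g}.
Proof.
have k1 : {ae Z, forall z, repr (kappa m P Q g) z =
  (repr (resample_cocycle m P g) z * (repr (resample_cocycle m Q g) z)^-1)%g}.
  have /unitary_eqP : to_unitary Z (repr (kappa m P Q g)) =
      to_unitary Z (circle_funM (repr (resample_cocycle m P g))
                                (circle_funV (repr (resample_cocycle m Q g)))).
    by rewrite -unitary_mulE -unitary_invE /to_unitary !reprK.
  by apply: filterS => z /(_ I).
have k2 := resample_cocycle_ae m P g; have k3 := resample_cocycle_ae m Q g.
by apply: filterS2 k1 (filterI k2 k3) => z -> [-> ->].
Qed.

(** Multiplying by the unimodular [b] turns closeness of a quotient to 1 into closeness of the two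
    values, which [coupling_L2] controls coordinatewise. *)
Let sqmod_sub (a b : circle R) : sqmod (val (a * b^-1)%g - 1) =
  (complex.Re (val a) - complex.Re (val b)) ^+ 2 +
  (complex.Im (val a) - complex.Im (val b)) ^+ 2.
Proof.
have -> : val (a * b^-1)%g - 1 = (val a - val b) * val (b^-1)%g.
  by rewrite mulrBl -circle_valM -circle_valM mulgV.
rewrite sqmodM [X in _ * X]circle_sqr mulr1 /sqmod.
by case: (val a) (val b) => ? ? [].
Qed.

Let kappa_close (P : nat -> seq (seq bool)) (b : nat -> seq bool) g :
  normsq Z (fun z => val (repr (kappa n (P n) (b n :: P n) g) z) - 1)
    @[n --> \oo] --> (0 : R).
Proof.
have [mr mi] := (measurable_circleP (repr (w g))).1 (@measurable_funPT _ _ _ _ (repr (w g))).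
have mpr m Q : mpres Z mu (resample A0 h m Q) by exact: (mpres_resample mu_prod).
have cvg A B : measurable A -> measurable B -> _ :=
  @resample_cvg _ _ _ _ _ _ mu_prod _ mA0 _ hI A0_gt0 A0_lt1 P b A B.
have sq1 (x y : R) : x ^+ 2 + y ^+ 2 = 1 -> `|x| <= 1.
  move=> xy; have : x ^+ 2 <= 1 by rewrite -xy lerDl sqr_ge0.
  by rewrite -[x ^+ 2]real_normK ?num_real// expr_le1.
have h1 := @coupling_L2 _ _ _ Z _ _ mu (fun n => resample A0 h n (P n))
  (fun n => resample A0 h n (b n :: P n)) (fun n => mpr _ _) (fun n => mpr _ _) cvg
  _ mr (fun x => sq1 _ _ (circle_sqr _)).
have h2 := @coupling_L2 _ _ _ Z _ _ mu (fun n => resample A0 h n (P n))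
  (fun n => resample A0 h n (b n :: P n)) (fun n => mpr _ _) (fun n => mpr _ _) cvg
  _ mi (fun x => sq1 _ _ (etrans (addrC _ _) (circle_sqr _))).
have h12 := cvgD h1 h2; rewrite addr0 in h12.
suff E n : normsq Z (fun z => val (repr (kappa n (P n) (b n :: P n) g) z) - 1) =
  \int[Z]_z (complex.Re (val (repr (w g) (resample A0 h n (P n) z))) -
     complex.Re (val (repr (w g) (resample A0 h n (b n :: P n) z)))) ^+ 2 +
  \int[Z]_z (complex.Im (val (repr (w g) (resample A0 h n (P n) z))) -
     complex.Im (val (repr (w g) (resample A0 h n (b n :: P n) z)))) ^+ 2.
  by under eq_fun do rewrite E; exact: h12.
set f := resample A0 h n (P n); set f' := resample A0 h n (b n :: P n).
have mpf : mpres Z mu f by exact: mpr.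
have mpf' : mpres Z mu f' by exact: mpr.
have isq (v : X -> R) : measurable_fun setT v -> (forall x, `|v x| <= 1) ->
    Z.-integrable setT (EFin \o (fun z => (v (f z) - v (f' z)) ^+ 2)).
  move=> mv v1; apply: (le_integrable measurableT (g := EFin \o cst 4)).
  - apply/measurable_EFinP; apply: measurable_funX; apply: measurable_funB.
      exact: (measurableT_comp mv mpf.1).
    exact: (measurableT_comp mv mpf'.1).
  - move=> z _ /=; rewrite lee_fin !ger0_norm ?sqr_ge0//.
    by have := v1 (f z); have := v1 (f' z); rewrite !ler_norml => /andP[? ?] /andP[? ?]; nra.
  - exact: finite_measure_integrable_cst.
have ir := isq _ mr (fun x => sq1 _ _ (circle_sqr _)).
have ii := isq _ mi (fun x => sq1 _ _ (etrans (addrC _ _) (circle_sqr _))).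
rewrite -[RHS](RintegralD measurableT ir ii) /normsq.
have [kr ki] := (measurable_circleP (repr (kappa n (P n) (b n :: P n) g))).1
  (@measurable_funPT _ _ _ _ _).
congr fine; apply: ae_eq_integral => //.
- apply/measurable_EFinP.
  have sq1E (c : R[i]) : complex.Re (c - 1) ^+ 2 + complex.Im (c - 1) ^+ 2 =
      (complex.Re c - 1) ^+ 2 + complex.Im c ^+ 2 by case: c => ? ? /=; rewrite subr0.
  under eq_fun do rewrite sq1E.
  by apply: measurable_funD; apply: measurable_funX => //; exact: measurable_funB.
- exact: (measurable_int _ (integrableD measurableT ir ii)).
apply: filterS (kappa_ae n (P n) (b n :: P n) g) => z kz _.
by rewrite kz -[in LHS]/(sqmod _) sqmod_sub.
Qed.

(** The length [m] has to be chosen before the list and the pattern. For each [m] a worst offender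
    is selected, that is, a pair at distance at least [e] if there is one; [kappa_close] along this
    sequence of pairs rules offenders out for large [m]. *)
Let kappa_uniformly_close (g : G) (e : R) : 0 < e -> \forall m \near \oo,
  forall P b, normsq Z (fun z => val (repr (kappa m P (b :: P) g) z) - 1) < e.
Proof.
move=> e0.
pose far m (p : seq (seq bool) * seq bool) :=
  e <= normsq Z (fun z => val (repr (kappa m p.1 (p.2 :: p.1) g) z) - 1).
(* When no pair is far, any value will do, and [([::], [::])] is taken. *)
have ex m : exists p, (exists q, far m q) -> far m p.
  by have [[q qP]|nq] := pselect (exists q, far m q); [exists q|exists ([::], [::]) => /nq].
have [p pP] := choice ex.
have /cvgrPdist_lt/(_ _ e0) := kappa_close (fun n => (p n).1) (fun n => (p n).2) g.
apply: filterS => m; rewrite sub0r normrN ger0_norm ?normsq_ge0// => pm P b.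
rewrite ltNge; apply/negP => fm.
by have := pP m (ex_intro _ (P, b) fm); rewrite /far leNgt pm.
Qed.

(** The rigidity data [s] and [e] involve finitely many group elements, so one [m] is good for all
    of them at once. *)
Let resample_step : exists m, forall P b, coboundary_on H (kappa m P (b :: P)).
Proof.
have [s [e [e0 se]]] := relT.
have e20 : 0 < e ^+ 2 by rewrite exprn_gt0.
have [m mP] : exists m, forall g, g \in s -> forall P b,
    normsq Z (fun z => val (repr (kappa m P (b :: P) g) z) - 1) < e ^+ 2.
  suff [N _ /(_ N (leqnn N))] : \forall m \near \oo, forall g, g \in s -> forall P b,
    normsq Z (fun z => val (repr (kappa m P (b :: P) g) z) - 1) < e ^+ 2.
    by exists N.
  elim: (s) => [|g s' IH]; first exact: nearW.
  apply: filterS2 (kappa_uniformly_close g e20) IH => m gm IH k.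
  by rewrite inE => /orP[/eqP->//|]; exact: IH.
exists m => P b.
exact: (rigid_coboundary Hh mixZ e0 se (fun g gs => mP g gs P b)).
Qed.

Let resample_coboundary : exists m, forall P, coboundary_on H (kappa m [::] P).
Proof.
have [m mP] := resample_step; exists m; elim=> [|b P IH].
  by rewrite /kappa mulgV; exact: coboundary_on1.
have -> : kappa m [::] (b :: P) = (kappa m [::] P * kappa m P (b :: P))%g.
  by rewrite /kappa mulgA mulgVK.
exact: coboundary_onM.
Qed.

Lemma bernoulli_cocycle_character :
  exists gamma : character R G, cocycle_equivalent w (character_cocycle sigma gamma).
Proof.
have [m mP] := resample_coboundary.
have [U UE] := mP (all_labels m).
pose u := repr U.
(* At the ends of the path [kappa] is the quotient of [w] at [x] by [w] at [y]; the coboundary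
   equation is solved for [u (k^-1 z)], the form in which [splitting] takes it. *)
have uE k : H k -> {ae Z, forall z, u (zeta k^-1%g z) =
    (u z * repr (w k) z.2.1 * (repr (w k) z.1)^-1)%g}.
  move=> Hk.
  have /unitary_eqP kU : to_unitary Z (repr (kappa m [::] (all_labels m) k)) =
      to_unitary Z (circle_funM u (circle_funV u \o zeta k^-1%g)).
    rewrite -unitary_mulE -unitary_actE -unitary_invE /to_unitary !reprK; exact: UE.
  apply: filterS2 kU (kappa_ae m [::] (all_labels m) k) => z /(_ I).
  rewrite resample0 resample_all => -> E.
  have {}E : (u z * (u (zeta k^-1%g z))^-1 = repr (w k) z.1 * (repr (w k) z.2.1)^-1)%g.
    exact: E.
  have -> : u (zeta k^-1%g z) = ((u z * (u (zeta k^-1%g z))^-1)^-1 * u z)%g.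
    by rewrite invgM invgK mulgVK.
  by rewrite E invgM invgK [LHS]circle_mulgC mulgA.
(* The second factor is the pair [(y, s)], and the cocycle on it depends on [y] alone, whereas [u]
   may depend on [s] too. *)
have [v mv vE] := splitting (w := fun k => repr (w k)) (w' := fun k t => repr (w k) t.1)
  Hh mix mixT (@measurable_funPT _ _ _ _ u) uE.
pose v' : {mfun X >-> circle R} := mfun_Sub (mem_set mv).
apply: (cocycle_extension Hh mix (v := to_unitary mu v')) => k Hk.
have [c vc] := vE k Hk; exists c.
rewrite [(to_unitary mu v')^-1%g]unitary_invE unitary_actE.
rewrite [(ucst _ _ * _)%g]unitary_mulE [RHS]unitary_mulE -[LHS]reprK.
by apply/unitary_eqP; apply: filterS vc => x -> _.
Qed.

End rigid_bernoulli.

Lemma infinite_set_sequence (T : Type) (A : set T) : infinite_set A ->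
  exists2 h : nat -> T, injective h & forall n, A (h n).
Proof.
move=> /infiniteP/card_leP[f].
pose i (n : nat) : set_type [set: nat] := SigSub (mem_set (I : [set: nat] n)).
exists (fun n => val (f (i n))) => [m n /val_inj fmn|n].
  by have /(congr1 val) : i m = i n by apply: (@inj _ _ _ f) => //; rewrite inE.
by have := valP (f (i n)); rewrite inE.
Qed.

Theorem corollary4p2 (R : realType) (G : groupType)
    (d : measure_display) (X0 : measurableType d)
    (mu0 : probability X0 R) (mu : probability (pow_space G X0) R)
    (mu_prod : is_product_measure mu0 mu) :
  countable [set: G] ->
  weakly_rigid R G ->
  standard_borel R X0 ->
  nontrivial_probability mu0 ->
  let sigma : mp_action G mu := bernoulli_shift mu_prod in
  [/\ (forall w : cocycle sigma, exists gamma : character R G,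
         cocycle_equivalent w (character_cocycle sigma gamma)),
      (forall gamma gamma' : character R G, gamma <> gamma' ->
         ~ cocycle_equivalent (character_cocycle sigma gamma)
                              (character_cocycle sigma gamma'))
    & {morph (character_class sigma : character R G -> H1 sigma) :
         a b / (a * b)%g >-> (a * b)%g} /\
      bijective (character_class sigma : character R G -> H1 sigma)].
Proof.
move=> _ [H [infH relT]] _ [A0 mA0 A01] sigma.
have [h hI Hh] := infinite_set_sequence infH.
have mix : mixing mu (fun n => sigma (h n)) by exact: bernoulli_mixing.
(* The set witnessing nontriviality supplies the bits of the labels; both strict bounds are needed
   for [label_bound] to be below 1. *)
have /andP[A0_gt0 A0_lt1] : 0 < pr mu0 A0 < 1 by move: A01; rewrite prE// !lte_fin.
have surj (w : cocycle sigma) : exists gamma : character R G,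
    cocycle_equivalent w (character_cocycle sigma gamma).
  exact: (bernoulli_cocycle_character mA0 A0_gt0 A0_lt1 hI Hh relT).
have rigid := character_rigid Hh mix.
split=> //.
  by move=> a b ab /rigid.
split.
  move=> a b; rewrite [RHS]quotient_mulE; congr (\pi_(quotient_group _)%qT _).
  by apply: cocycle_ext => g; exact: ucstM.
have class_inj : injective (character_class sigma : character R G -> H1 sigma).
  by move=> a b /cohomology_classP /rigid.
have inv (x : H1 sigma) : exists a : character R G, character_class sigma a = x.
  elim/quotient_ind: x => w; have [a wa] := surj w; exists a.
  by apply/esym/cohomology_classP.
have [f fE] := choice inv.
by exists f => // a; apply: class_inj; rewrite fE.
Qed.
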